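(* Suppose the stepsizes are $\alpha_k=\frac{\theta}{\mu(k+K)}$ for all $k\ge 0$ with $\theta>2$ and $K=\left\lceil\frac{2\theta(1+M)L^2}{\mu^2}\right\rceil$, and let $K_1=\left\lceil\max\left\{2K,\frac{16}{1-\rho_w^2}\right\}\right\rceil$ and $\tilde k=k+K$. Then the DSGD iterates satisfy, for all $k\ge K_1-K$, $$\frac1n\sum_{i=1}^n\mathbb{E}\left[\|x_i(k)-x_*\|^2\right]\le \frac{\theta^2\bar M}{(2\theta-1)n\mu^2\tilde k}+\mathcal{O}\left(\frac{\sqrt{A+B+n}}{n(1-\rho_w)}\right)\frac{1}{\tilde k^{1.5}}+\mathcal{O}\left(\frac{A+B+n}{n(1-\rho_w)^2}\right)\frac{1}{\tilde k^{2}}.$$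
   Context: Objectives: $n,p,m\ge 1$ are integers and $\mathcal N=\{1,\dots,n\}$. Each $f_i:\mathbb{R}^p\to\mathbb{R}$, $i\in\mathcal N$, is differentiable, $\mu$-strongly convex with $L$-Lipschitz gradient ($\mu,L>0$): $\langle\nabla f_i(x)-\nabla f_i(x'),x-x'\rangle\ge\mu\|x-x'\|^2$ and $\|\nabla f_i(x)-\nabla f_i(x')\|\le L\|x-x'\|$ for all $x,x'$. Let $f=\frac1n\sum_i f_i$; $x_*$ is its unique minimizer. Network: the agents interact over an undirected connected graph on $\mathcal N$. The mixing matrix $\mathbf W=[w_{ij}]\in\mathbb{R}^{n\times n}$ is nonnegative, satisfies $w_{ij},w_{ji}>0$ if $i,j$ are connected by an edge and $w_{ij}=w_{ji}=0$ otherwise ($i\ne j$), and is doubly stochastic: $\mathbf W\mathbf 1=\mathbf 1$, $\mathbf 1^\top\mathbf W=\mathbf 1^\top$. $\rho_w$ is the spectral norm of $\mathbf W-\frac1n\mathbf 1\mathbf 1^\top$, and $\rho_w<1$. Algorithm (DSGD): from arbitrary deterministic $x_i(0)\in\mathbb{R}^p$, $x_i(k+1)=\sum_{j=1}^n w_{ij}\left(x_j(k)-\alpha_k g_j(k)\right)$, $k\ge0$, where $g_j(k)=g_j(x_j(k),\xi_j(k))\in\mathbb{R}^p$ and $\xi_j(k)$ are random vectors in $\mathbb{R}^m$. Noise: let $\mathcal F(k)$ be the $\sigma$-algebra generated by $\{x_i(0),\dots,x_i(k): i\in\mathcal N\}$. For every $k\ge0$ the vectors $\xi_1(k),\dots,\xi_n(k)$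 are independent across $i$ conditionally on $\mathcal F(k)$, $\mathbb{E}[g_i(k)\mid\mathcal F(k)]=\nabla f_i(x_i(k))$, and $\mathbb{E}[\|g_i(k)-\nabla f_i(x_i(k))\|^2\mid\mathcal F(k)]\le\sigma^2+M\|\nabla f_i(x_i(k))\|^2$ for some constants $\sigma,M>0$. Notation: $A=\sum_{i=1}^n\|x_i(0)-x_*\|^2$, $B=\sum_{i=1}^n\|\nabla f_i(x_* )\|^2$, $\bar M=\frac{2M\sum_{i=1}^n\|\nabla f_i(x_* )\|^2}{n}+\sigma^2$. $\mathcal{O}(\cdot)$ hides constants depending only on $\theta,\mu,L,\sigma,M$ (not on $k,n,p,\rho_w,A,B$). *)

(* Defs.v *)
From HB Require Import structures.
From mathcomp Require Import all_boot all_order all_algebra.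
From mathcomp Require Import all_classical all_reals all_analysis.

Set Implicit Arguments.
Unset Strict Implicit.
Unset Printing Implicit Defensive.

Import Order.TTheory GRing.Theory Num.Theory.
Import numFieldNormedType.Exports.

Local Open Scope classical_set_scope.
Local Open Scope ring_scope.

(* The norm that the library puts on 'rV[R]_p is the sup norm: it only serves
   as the (equivalent) topology used by differentiability.  All quantitative
   statements use the Euclidean inner product and norm below. *)
Section euclidean.
Context {R : realType}.

Definition dotp p (u v : 'rV[R]_p) : R := \sum_(j < p) u 0 j * v 0 j.

Definition sqnorm p (u : 'rV[R]_p) : R := dotp u u.

Definition norm2 p (u : 'rV[R]_p) : R := Num.sqrt (sqnorm u).

(* Operator norm induced by the Euclidean norm; the vectors of R^n are stored
   as rows, so v *m A^T is the transpose of the column A v^T. *)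
Definition spectral_norm n (A : 'M[R]_n) : R :=
  sup [set norm2 (v *m A^T) | v in [set v : 'rV[R]_n | norm2 v <= 1]].

Definition gradient p (f : 'rV[R]_p -> R) (x : 'rV[R]_p) : 'rV[R]_p :=
  \row_(j < p) 'D_(delta_mx 0 j) (f : 'rV[R]_p -> R^o) x.

Definition strongly_convex_smooth p (mu L : R) (f : 'rV[R]_p -> R) : Prop :=
  [/\ forall x : 'rV[R]_p, differentiable (f : 'rV[R]_p -> R^o) x,
      forall x y : 'rV[R]_p,
        mu * sqnorm (x - y) <= dotp (gradient f x - gradient f y) (x - y)
    & forall x y : 'rV[R]_p,
        norm2 (gradient f x - gradient f y) <= L * norm2 (x - y)].

Definition average n p (f : 'I_n -> 'rV[R]_p -> R) (x : 'rV[R]_p) : R :=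
  n%:R^-1 * \sum_(i < n) f i x.

Definition is_minimizer p (f : 'rV[R]_p -> R) (x : 'rV[R]_p) : Prop :=
  forall y : 'rV[R]_p, f x <= f y.

End euclidean.

Section network.
Context {R : realType}.

Definition connected_graph n (E : rel 'I_n) : Prop :=
  [/\ symmetric E, irreflexive E & forall i j, connect E i j].

(* The diagonal entries of W may vanish. *)
Definition mixing_matrix n (E : rel 'I_n) (W : 'M[R]_n) : Prop :=
  [/\ forall i j, 0 <= W i j,
      forall i j, E i j -> 0 < W i j /\ 0 < W j i,
      forall i j, i != j -> ~~ E i j -> W i j = 0 /\ W j i = 0,
      W *m const_mx 1 = const_mx 1 :> 'cV[R]_n
    & const_mx 1 *m W = const_mx 1 :> 'rV[R]_n].

Definition rho_w n (W : 'M[R]_n) : R :=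
  spectral_norm (W - n%:R^-1 *: const_mx 1).

End network.

(* Borel sigma-algebra of R^p, generated by the coordinates as the library does
   for tuples. *)
Section measurable_rV.
Context {R : realType} (p : nat).

Let coord (j : 'I_p) (v : 'rV[R]_p) : R := v 0 j.

Let rV_set0 : g_sigma_preimage coord set0.
Proof. exact: sigma_algebra0. Qed.

Let rV_setC A : g_sigma_preimage coord A -> g_sigma_preimage coord (~` A).
Proof. exact: sigma_algebraC. Qed.

Let rV_bigcup (F : (set 'rV[R]_p)^nat) :
  (forall i, g_sigma_preimage coord (F i)) ->
  g_sigma_preimage coord (\bigcup_i (F i)).
Proof. exact: sigma_algebra_bigcup. Qed.

HB.instance Definition _ := @isMeasurable.Build default_measure_display
  'rV[R]_p (g_sigma_preimage coord) rV_set0 rV_setC rV_bigcup.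

End measurable_rV.

Section conditioning.
Context d (T : measurableType d) (R : realType) (P : probability T R).

(* Y is a version of E[X | G], for G a sub-sigma-algebra. *)
Definition is_condexp (X : T -> R) (G : set (set T)) (Y : T -> R) : Prop :=
  [/\ P.-integrable setT (EFin \o X),
      P.-integrable setT (EFin \o Y),
      g_sigma_algebra_preimage Y `<=` G
    & forall A, G A ->
        (\int[P]_(w in A) (X w)%:E = \int[P]_(w in A) (Y w)%:E)%E].

(* E[X | G] <= Y almost surely. *)
Definition condexp_le (X : T -> R) (G : set (set T)) (Y : T -> R) : Prop :=
  exists Z : T -> R, is_condexp X G Z /\ {ae P, forall w, Z w <= Y w}.

(* P(X_i \in B_i for all i | G) = \prod_i P(X_i \in B_i | G).  Versions q i of
   the factors always exist and are a.e. unique, and sub-families are covered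
   by taking B i = setT. *)
Definition cond_independent n m (X : 'I_n -> T -> 'rV[R]_m)
    (G : set (set T)) : Prop :=
  forall B : 'I_n -> set 'rV[R]_m, (forall i, measurable (B i)) ->
  exists q : 'I_n -> T -> R,
    (forall i, is_condexp \1_(X i @^-1` B i) G (q i)) /\
    is_condexp \1_(\bigcap_(i in [set: 'I_n]) X i @^-1` B i) G
      (fun w => \prod_(i < n) q i w).

End conditioning.

Section dsgd.
Context {R : realType} (T : Type) (n p m : nat).
Variables (W : 'M[R]_n) (alpha : nat -> R)
  (g : 'I_n -> 'rV[R]_p -> 'rV[R]_m -> 'rV[R]_p)
  (xi : nat -> 'I_n -> T -> 'rV[R]_m) (x0 : 'I_n -> 'rV[R]_p).

Fixpoint dsgd (k : nat) (i : 'I_n) (w : T) : 'rV[R]_p :=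
  if k is k'.+1 then
    \sum_(j < n) W i j *:
      (dsgd k' j w - alpha k' *: g j (dsgd k' j w) (xi k' j w))
  else x0 i.

Definition sgrad (k : nat) (i : 'I_n) (w : T) : 'rV[R]_p :=
  g i (dsgd k i w) (xi k i w).

End dsgd.

(* sigma-algebra generated by x_i(0), ..., x_i(k), for all i *)
Definition history d (T : measurableType d) (R : realType) n p
    (x : nat -> 'I_n -> T -> 'rV[R]_p) (k : nat) : set (set T) :=
  <<s \bigcup_(l in [set l : nat | (l <= k)%N])
        \bigcup_(i in [set: 'I_n]) g_sigma_algebra_preimage (x l i) >>.

Definition noise_assumption d (T : measurableType d) (R : realType)
    (P : probability T R) n p m (sigma M : R) (f : 'I_n -> 'rV[R]_p -> R)
    (x gs : nat -> 'I_n -> T -> 'rV[R]_p) (xi : nat -> 'I_n -> T -> 'rV[R]_m) :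
    Prop :=
  forall k : nat,
  [/\ cond_independent P (xi k) (history x k),
      forall (i : 'I_n) (j : 'I_p),
        is_condexp P (fun w => gs k i w 0 j) (history x k)
          (fun w => gradient (f i) (x k i w) 0 j)
    & forall i : 'I_n,
        condexp_le P
          (fun w => sqnorm (gs k i w - gradient (f i) (x k i w)))
          (history x k)
          (fun w => sigma ^+ 2 + M * sqnorm (gradient (f i) (x k i w)))].

Section constants.
Context {R : realType}.

Definition shiftK (theta mu L M : R) : int :=
  Num.ceil (2 * theta * (1 + M) * L ^+ 2 / mu ^+ 2).

Definition transientK1 (K : int) (rho : R) : int :=
  Num.ceil (Num.max (2 * K%:~R) (16 / (1 - rho ^+ 2))).

Definition stepsize (theta mu : R) (K : int) (k : nat) : R :=
  theta / (mu * (k%:Z + K)%:~R).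

Definition init_dist n p (x0 : 'I_n -> 'rV[R]_p) (xs : 'rV[R]_p) : R :=
  \sum_(i < n) sqnorm (x0 i - xs).

Definition grad_dissim n p (f : 'I_n -> 'rV[R]_p -> R) (xs : 'rV[R]_p) : R :=
  \sum_(i < n) sqnorm (gradient (f i) xs).

Definition Mbar n p (sigma M : R) (f : 'I_n -> 'rV[R]_p -> R)
    (xs : 'rV[R]_p) : R :=
  2 * M * (\sum_(i < n) sqnorm (gradient (f i) xs)) / n%:R + sigma ^+ 2.

End constants.

(* Main.v *)
Require Import Defs.
From mathcomp Require Import all_boot all_order all_algebra.
From mathcomp Require Import all_classical all_reals all_analysis.
From mathcomp Require Import measurable_realfun.
From mathcomp Require Import ring lra.

(** Write [t = k + K], [S = A + B + n], and split the error around the average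
    [mean x] of the agents: the left-hand side of the theorem is exactly
    [r + v / n] ([dist_errE]), where [r] is the expected squared distance of
    [mean x] to [xs] and [v] is the consensus error, the expected total squared
    distance of the agents to [mean x].  One step of the algorithm yields three
    recursions.

    - [dist_recursion]: averaging by a doubly stochastic matrix does not
      increase [n r + v], and a gradient step contracts it up to a source of
      order [B + n].  Hence [n r + v = O(S)] at all times.
    - [cons_recursion]: [W - 1 1^T / n] has norm [rho] and kills constants, so
      [v] is contracted by [(1 + rho^2) / 2] up to a source
      [O(S / ((1 - rho) t^2))].  As soon as [t >= 16 / (1 - rho^2)], [1 / t^2]
      decays more slowly than this contraction, and before that the bound
      [O(S)] is already as good; hence [v = O(S / ((1 - rho)^2 t^2))].
    - [opt_recursion]: [mean x] performs a gradient step on the average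
      objective, perturbed by [v] and by a noise whose variance is divided by
      [n] because the noises of distinct agents are uncorrelated.

    The bounds on [n r + v] and [v] turn the third recursion into a scalar one.
    It is used twice.  First crudely, with a contraction factor [1 - c / t],
    [c > 2], which gives
    [r = O((1 + B / n) / (n t)) + O(S / (n (1 - rho)^2 t^2))] ([opt_crude]).
    Then with the exact factor [1 - 2 theta / t]: all terms of the recursion in
    which [r] is multiplied by the square of the step size are now of higher
    order, and the noise term alone produces
    [theta^2 Mbar / ((2 theta - 1) n mu^2 t)] ([decay_rate], [mse_bound]).

    The delicate term is the interaction [sqrt (r v / n) / t] between the two
    errors.  Since [B / n] is not bounded by the hidden constants, the part of
    [r] proportional to [B] could contribute more than
    [sqrt S / (n (1 - rho) t^(3/2))].  It is absorbed in the leading term: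
    [Mbar] contains [2 M B / n] whereas the noise at [x_i] is at most
    [sigma^2 + M ((3/2) |grad f_i xs|^2 + 3 L^2 |x_i - xs|^2)], and the
    remaining [M B / (2 n)] pays for that part by the inequality between
    arithmetic and geometric means ([cross_term], [opt_refined]).

    On the probabilistic side, the absence of correlation between two agents is
    derived from the factorisation of conditional probabilities by two
    applications of the pi-lambda theorem, one for each agent
    ([cond_independent_pair], [cond_independent_orth]). *)

Set Implicit Arguments.
Unset Strict Implicit.
Unset Printing Implicit Defensive.
Import Order.TTheory GRing.Theory Num.Theory.
Import numFieldNormedType.Exports.
Local Open Scope classical_set_scope.
Local Open Scope ring_scope.

(** * Decay rates of scalar recursions *)

Section decay.
Context {R : realType}.
Implicit Types (t c : R).

Lemma inv_succ_ge t : 0 < t -> (1 - t^-1) / t <= (t + 1)^-1.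
Proof.
move=> t0; have t1 : 0 < t + 1 by lra.
have -> : (1 - t^-1) / t = (t + 1)^-1 - (t ^+ 2 * (t + 1))^-1.
  by field; rewrite !gt_eqF.
by rewrite lerBlDr lerDl invr_ge0 mulr_ge0 ?sqr_ge0 ?ltW.
Qed.

Lemma inv_sqr_succ_ge t : 0 < t -> (1 - 2 / t) / t ^+ 2 <= ((t + 1) ^+ 2)^-1.
Proof.
move=> t0; have t1 : 0 < t + 1 by lra.
have -> : (1 - 2 / t) / t ^+ 2 =
   ((t + 1) ^+ 2)^-1 - (3 * t + 2) / (t ^+ 3 * (t + 1) ^+ 2).
  by field; rewrite !gt_eqF.
rewrite lerBlDr lerDl divr_ge0 ?mulr_ge0 ?exprn_ge0 //; lra.
Qed.

(** [t^(-3/2)] decays more slowly than [t^(-2)], so the factor [1 - 2 / t] that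
    suits the latter also suits the former. *)
Lemma inv_sqrt_succ_ge t : 0 < t ->
  (1 - 2 / t) / (t * Num.sqrt t) <= ((t + 1) * Num.sqrt (t + 1))^-1.
Proof.
move=> t0; have t1 : 0 < t + 1 by lra.
have s0 : 0 < Num.sqrt t by rewrite sqrtr_gt0.
have s1 : 0 < Num.sqrt (t + 1) by rewrite sqrtr_gt0.
have ss : Num.sqrt t <= Num.sqrt (t + 1) by rewrite ler_sqrt; lra.
have [neg|pos] := lerP (1 - 2 / t) 0.
  apply: (@le_trans _ _ 0); last by rewrite invr_ge0 mulr_ge0 // ltW.
  by rewrite mulr_le0_ge0 // invr_ge0 mulr_ge0 // ltW.
have -> : (1 - 2 / t) / (t * Num.sqrt t) = (1 - 2 / t) / t ^+ 2 * Num.sqrt t.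
  rewrite -[in RHS](sqr_sqrtr (ltW t0)) -[in LHS](sqr_sqrtr (ltW t0)).
  set u := Num.sqrt t in s0 *.
  have -> : Num.sqrt (u ^+ 2) = u by rewrite sqrtr_sqr gtr0_norm.
  by field; rewrite gt_eqF.
have -> : ((t + 1) * Num.sqrt (t + 1))^-1 =
    ((t + 1) ^+ 2)^-1 * Num.sqrt (t + 1).
  rewrite -{1 3}(sqr_sqrtr (ltW t1)).
  set u := Num.sqrt (t + 1) in s1 *.
  by field; rewrite gt_eqF.
apply: ler_pM => //; first by rewrite divr_ge0 ?exprn_ge0 // ltW.
exact: inv_sqr_succ_ge.
Qed.

(** The bound propagates by induction: the contraction [1 - c / t] leaves a margin
    of [c - 1] over the decay of [P / t], and of at least [c - 2] over that of
    the two faster terms, which absorbs the sources.  The initial error is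
    carried by the fastest term. *)
Lemma decay_rate (kap c P Q Z : R) (r : nat -> R) : 2 <= c -> c <= kap ->
  0 <= P -> 0 <= Q -> 0 <= Z -> r 0%N <= Z / kap ^+ 2 ->
  (forall k, let t := k%:R + kap in
    r k.+1 <= (1 - c / t) * r k + (c - 1) * P / t ^+ 2
      + (c - 2) * Q / (t ^+ 2 * Num.sqrt t) + (c - 2) * Z / t ^+ 3) ->
  forall k, let t := k%:R + kap in
    r k <= P / t + Q / (t * Num.sqrt t) + Z / t ^+ 2.
Proof.
move=> c2 ck P0 Q0 Z0 r0 rec; elim=> [|k IH] /=.
  rewrite add0r; apply: (le_trans r0); rewrite lerDr addr_ge0 //.
    by rewrite divr_ge0 //; lra.
  by rewrite divr_ge0 // mulr_ge0 ?sqrtr_ge0 //; lra.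
have k0 : 0 <= k%:R :> R by [].
have -> : k.+1%:R + kap = (k%:R + kap) + 1 :> R by rewrite -natr1; ring.
move: (rec k) IH => /=; set t := k%:R + kap => rk IH.
have t0 : 0 < t by rewrite /t; lra.
have ct : 0 <= 1 - c / t.
  by rewrite subr_ge0 ler_pdivrMr // mul1r /t; lra.
have h1 := ler_wpM2l P0 (inv_succ_ge t0).
have h2 := ler_wpM2l Q0 (inv_sqrt_succ_ge t0).
have h3 := ler_wpM2l Z0 (inv_sqr_succ_ge t0).
apply: (le_trans rk); apply: (le_trans _ (lerD (lerD h1 h2) h3)).
have s0 : 0 < Num.sqrt t by rewrite sqrtr_gt0.
apply: (@le_trans _ _ ((1 - c / t) * (P / t + Q / (t * Num.sqrt t) + Z / t ^+ 2)
    + (c - 1) * P / t ^+ 2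
      + (c - 2) * Q / (t ^+ 2 * Num.sqrt t) + (c - 2) * Z / t ^+ 3)).
  by rewrite !lerD2r; exact: ler_wpM2l.
rewrite le_eqVlt; apply/orP; left; apply/eqP.
set u := Num.sqrt t in s0 *.
by field; rewrite !gt_eqF.
Qed.

End decay.

(** * The three error recursions as real sequences *)

Section recursions.
Context {R : realType} (theta mu L sigma M : R).
Hypotheses (htheta : 2 < theta) (hmu : 0 < mu) (hL : 0 < L)
    (hsigma : 0 < sigma) (hM : 0 < M).

Definition minshift : R := 2 * theta * (1 + M) * L ^+ 2 / mu ^+ 2.
Definition maxstep : R := mu / (2 * (1 + M) * L ^+ 2).

(** The hidden constants of the successive bounds: [dist_const * S] bounds the
    total error, [cons_source] is the strength of the source in the consensus
    recursion and [cons_const] the constant of the resulting [1 / t^2] rate. *)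
Definition dist_const : R :=
  1 + 2 / mu * (2 / mu + 2 * maxstep * (1 + M) + maxstep * sigma ^+ 2).
Definition cons_source : R :=
  theta ^+ 2 / mu ^+ 2 * ((1 + M) * (2 * L ^+ 2 * dist_const + 2) + sigma ^+ 2).
Definition cons_const : R :=
  2 * cons_source + (81 + (minshift + 1) ^+ 2) * dist_const.

Variables (N rho A B kap : R) (r v : nat -> R).
Hypotheses (hN : 1 <= N) (hrho : 0 <= rho < 1) (hA : 0 <= A) (hB : 0 <= B).
Hypotheses (hLmu : mu <= L) (kap_ge : minshift <= kap) (kap_le : kap <= minshift + 1).
Hypotheses (r_ge0 : forall k, 0 <= r k) (v_ge0 : forall k, 0 <= v k).

Variables (t a : nat -> R).
Hypotheses (tE : forall k, t k = k%:R + kap)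
  (aE : forall k, a k = theta / (mu * t k)).
Let S : R := A + B + N.
Let H k : R := N * r k + v k.
Let lam : R := (1 - rho ^+ 2) / 2.

Ltac std_lra := move: (htheta) (hmu) (hL) (hsigma) (hM) (hN) (hA) (hB) (hLmu)
  (kap_ge) (kap_le) => *; lra.
Ltac std_nra := move: (htheta) (hmu) (hL) (hsigma) (hM) => *; nra.

Lemma minshift_ge : 2 * theta * (1 + M) <= minshift.
Proof.
rewrite /minshift ler_pdivlMr ?exprn_gt0 // ler_wpM2l //; first by rewrite mulr_ge0 //; std_lra.
by rewrite ler_sqr ?nnegrE // ltW.
Qed.

Lemma minshift_theta : 2 * theta <= minshift.
Proof. by apply: le_trans minshift_ge; rewrite ler_peMr //; std_lra. Qed.

Lemma time_ge k : 2 * theta <= t k.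
Proof.
have := minshift_theta; have : 0 <= k%:R :> R by []. by rewrite tE; std_lra.
Qed.

Lemma time_gt4 k : 4 < t k.
Proof. by have := time_ge k; std_lra. Qed.

Lemma time_gt0 k : 0 < t k.
Proof. by have := time_gt4 k; std_lra. Qed.

Lemma time_succ k : t k.+1 = t k + 1.
Proof. by rewrite !tE -natr1; ring. Qed.

Lemma step_gt0 k : 0 < a k.
Proof. by rewrite aE divr_gt0 ?mulr_gt0 ?time_gt0 //; std_lra. Qed.

Lemma step_mu k : a k * mu = theta / t k.
Proof. by rewrite aE; field; rewrite !gt_eqF ?time_gt0. Qed.

Lemma step_mu_le k : a k * mu <= 1 / 2.
Proof. by rewrite step_mu ler_pdivrMr ?time_gt0 //; have := time_ge k; std_lra. Qed.

Lemma maxstep_gt0 : 0 < maxstep.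
Proof. by rewrite divr_gt0 // !mulr_gt0 ?exprn_gt0 //; std_lra. Qed.

Lemma step_le k : a k <= maxstep.
Proof.
have M1 : 0 < 1 + M by std_lra.
have q0 : 0 < minshift by have := minshift_theta; std_lra.
have -> : maxstep = theta / (mu * minshift).
  rewrite /maxstep /minshift; field; rewrite !gt_eqF //; std_lra.
rewrite aE ler_wpM2l //; first std_lra.
rewrite lef_pV2 ?posrE ?(mulr_gt0 hmu) ?time_gt0 // ler_wpM2l ?(ltW hmu) //.
by apply: (le_trans kap_ge); rewrite tE lerDr.
Qed.

Lemma step_smooth k : 2 * (1 + M) * (a k * L ^+ 2) <= mu.
Proof.
have -> : mu = 2 * (1 + M) * (maxstep * L ^+ 2).
  by rewrite /maxstep; field; rewrite !gt_eqF //; std_lra.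
rewrite ler_wpM2l //; first by std_lra.
by rewrite ler_wpM2r ?sqr_ge0 ?step_le.
Qed.

Lemma total_ge1 : 1 <= S. Proof. by rewrite /S; std_lra. Qed.

Lemma gap_gt0 : 0 < lam.
Proof. by rewrite /lam; case/andP: hrho => h0 h1; std_nra. Qed.

Lemma gap_le : lam <= 1 / 2.
Proof. by rewrite /lam; have := sqr_ge0 rho; std_lra. Qed.

Lemma gap_ge : (1 - rho) / 2 <= lam.
Proof. by rewrite /lam; case/andP: hrho => h0 h1; std_nra. Qed.

Lemma dist_const_ge1 : 1 <= dist_const.
Proof.
rewrite /dist_const lerDl mulr_ge0 ?divr_ge0 ?(ltW hmu) //.
have m0 := ltW maxstep_gt0; have i0 : 0 <= mu^-1 by rewrite invr_ge0 ltW.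
have h1 := mulr_ge0 m0 (ltW hM); have h2 := mulr_ge0 m0 (sqr_ge0 sigma).
by std_lra.
Qed.

Hypothesis init : H 0%N <= A.

Hypothesis dist_rec : forall k, H k.+1 <= (1 - a k * mu / 2) * H k
  + a k * (2 / mu * B + 2 * a k * (1 + M) * B + a k * N * sigma ^+ 2).

Lemma dist_ge0 k : 0 <= H k.
Proof. by rewrite /H addr_ge0 // mulr_ge0 //; std_lra. Qed.

(** The contraction [1 - a mu / 2] and the source are both of the order of the
    step size [a], so their fixed point is independent of it. *)
Lemma dist_bounded k : H k <= dist_const * S.
Proof.
have S1 := total_ge1; have D1 := dist_const_ge1.
elim: k => [|k IH].
  apply: (le_trans init); apply: (@le_trans _ _ S); first by rewrite /S; std_lra.
  by rewrite ler_peMl //; std_lra.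
apply: (le_trans (dist_rec k)).
have a0 := step_gt0 k; have aM := step_le k; have am := step_mu_le k.
have m0 := maxstep_gt0.
set c := 2 / mu + 2 * maxstep * (1 + M) + maxstep * sigma ^+ 2.
have cE : dist_const = 1 + 2 / mu * c by [].
have src : 2 / mu * B + 2 * a k * (1 + M) * B + a k * N * sigma ^+ 2 <= c * S.
  have mu2 : 0 < 2 / mu by rewrite divr_gt0.
  have s2 := sqr_ge0 sigma.
  apply: (@le_trans _ _ (2 / mu * S + 2 * maxstep * (1 + M) * S
      + maxstep * sigma ^+ 2 * S)); last by rewrite /c -!mulrDl.
  rewrite !lerD //.
  - by rewrite ler_wpM2l ?(ltW mu2) // /S; std_lra.
  - apply: ler_pM => //; last by rewrite /S; std_lra.
      by rewrite !mulr_ge0 //; std_lra.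
    by rewrite ler_wpM2r //; std_lra.
  - rewrite mulrAC; apply: ler_pM => //; last by rewrite /S; std_lra.
    + by rewrite mulr_ge0 // ltW.
    + by std_lra.
    + by rewrite ler_wpM2r.
have h1 : (1 - a k * mu / 2) * H k <= (1 - a k * mu / 2) * (dist_const * S).
  by apply: ler_wpM2l => //; std_lra.
have h2 := ler_wpM2l (ltW a0) src.
apply: (le_trans (lerD h1 h2)).
rewrite cE.
have -> : (1 - a k * mu / 2) * ((1 + 2 / mu * c) * S) + a k * (c * S) =
   (1 + 2 / mu * c) * S - a k * mu / 2 * S.
  by field; rewrite gt_eqF.
by rewrite lerBlDr lerDl !mulr_ge0 //; std_lra.
Qed.

Hypothesis cons_rec : forall k, v k.+1 <= (1 - lam) * v k
  + a k ^+ 2 * ((lam^-1 + M) * (2 * L ^+ 2 * H k + 2 * B) + N * sigma ^+ 2).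

Lemma cons_source_ge0 : 0 <= cons_source.
Proof.
have D1 := dist_const_ge1.
have h : 0 <= L ^+ 2 * dist_const by rewrite mulr_ge0 ?sqr_ge0 //; std_lra.
apply: mulr_ge0; first by rewrite divr_ge0 ?sqr_ge0.
apply: addr_ge0 (sqr_ge0 _); apply: mulr_ge0; std_lra.
Qed.

Lemma cons_rec_decay k :
  v k.+1 <= (1 - lam) * v k + cons_source * S / (lam * t k ^+ 2).
Proof.
apply: (le_trans (cons_rec k)); rewrite lerD2l.
have l0 := gap_gt0; have l1 := gap_le; have Hk := dist_bounded k.
have D1 := dist_const_ge1; have S1 := total_ge1.
have -> : cons_source * S / (lam * t k ^+ 2) = a k ^+ 2 *
   (lam^-1 * (((1 + M) * (2 * L ^+ 2 * dist_const + 2) + sigma ^+ 2) * S)).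
  by rewrite /cons_source aE; field; rewrite !gt_eqF // time_gt0.
rewrite ler_wpM2l ?sqr_ge0 //.
have il : 1 <= lam^-1 by rewrite invf_ge1 //; std_lra.
have -> : lam^-1 * (((1 + M) * (2 * L ^+ 2 * dist_const + 2) + sigma ^+ 2) * S)
  = (lam^-1 + M * lam^-1) * (2 * L ^+ 2 * (dist_const * S) + 2 * S)
    + lam^-1 * (S * sigma ^+ 2) by ring.
have N0 : 0 <= N by std_lra.
apply: lerD.
  apply: ler_pM.
  - by rewrite addr_ge0 //; std_lra.
  - by have := mulr_ge0 (sqr_ge0 L) (dist_ge0 k); std_lra.
  - by rewrite lerD2l ler_peMr //; std_lra.
  - apply: lerD; last by rewrite /S; std_lra.
    by rewrite ler_wpM2l // mulr_ge0 // sqr_ge0.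
apply: (@le_trans _ _ (S * sigma ^+ 2)).
  by rewrite ler_wpM2r ?sqr_ge0 // /S; std_lra.
by rewrite ler_peMl // mulr_ge0 ?sqr_ge0 //; std_lra.
Qed.

(** Beyond [t = 8 / lam = 16 / (1 - rho^2)] the sequence [1 / t^2] decreases by a
    factor of at least [1 - lam / 2] per step, so the rate is preserved by the
    recursion.  Before that [lam t] is bounded and the uniform bound on the total
    error suffices. *)
Lemma cons_bound_gap k : v k <= cons_const * S / (lam ^+ 2 * t k ^+ 2).
Proof.
have l0 := gap_gt0; have l1 := gap_le.
have D1 := dist_const_ge1; have S1 := total_ge1; have c0 := cons_source_ge0.
have q2 : 0 <= (minshift + 1) ^+ 2 by exact: sqr_ge0.
have vH j : v j <= dist_const * S.
  apply: le_trans (dist_bounded j); rewrite /H lerDr mulr_ge0 //; std_lra.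
have cc : 0 <= cons_const by rewrite /cons_const addr_ge0 // mulr_ge0 //; std_lra.
have small x j : lam * t j <= x -> 0 <= x ->
    x ^+ 2 * dist_const <= cons_const ->
    v j <= cons_const * S / (lam ^+ 2 * t j ^+ 2).
  move=> lt x0 xc; apply: (le_trans (vH j)).
  rewrite ler_pdivlMr; last by rewrite mulr_gt0 ?exprn_gt0 ?time_gt0.
  rewrite mulrAC ler_wpM2r //; first std_lra.
  apply: le_trans xc; rewrite mulrC ler_wpM2r //; first std_lra.
  by rewrite -exprMn ler_sqr ?nnegrE // mulr_ge0 ?(ltW l0) ?(ltW (time_gt0 _)).
elim: k => [|k IH].
  apply: (small (minshift + 1)).
  - rewrite tE add0r; apply: le_trans kap_le.
    by rewrite ger_pMl; have := time_gt0 0; rewrite tE add0r; std_lra.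
  - by have := minshift_theta; std_lra.
  - by rewrite /cons_const; std_nra.
(* [lam t >= 8] is needed one step earlier, whence the threshold 9. *)
have [le9|gt9] := lerP (lam * t k.+1) 9.
  apply: (small 9) => //; rewrite /cons_const.
  have := mulr_ge0 q2 (le_trans ler01 D1); std_lra.
apply: (le_trans (cons_rec_decay k)).
have t0 := time_gt0 k.
have lt8 : 8 <= lam * t k by move: gt9; rewrite time_succ; std_lra.
have h1 : (1 - lam) * v k <=
    (1 - lam) * (cons_const * S / (lam ^+ 2 * t k ^+ 2)).
  by apply: ler_wpM2l => //; std_lra.
apply: (le_trans (lerD h1 (lexx _))).
have h2 : cons_source <= cons_const / 2.
  rewrite /cons_const.
  have : 0 <= (81 + (minshift + 1) ^+ 2) * dist_const by rewrite mulr_ge0 //; std_lra.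
  by std_lra.
have -> : (1 - lam) * (cons_const * S / (lam ^+ 2 * t k ^+ 2)) +
   cons_source * S / (lam * t k ^+ 2) =
   S / (lam ^+ 2 * t k ^+ 2) * ((1 - lam) * cons_const + lam * cons_source).
  by field; rewrite !gt_eqF.
have h3 : (1 - lam) * cons_const + lam * cons_source <=
    (1 - lam / 2) * cons_const.
  have := ler_wpM2l (ltW l0) h2; std_lra.
have p0 : 0 <= S / (lam ^+ 2 * t k ^+ 2).
  apply: divr_ge0; first by std_lra.
  by rewrite mulr_ge0 ?sqr_ge0.
apply: (le_trans (ler_wpM2l p0 h3)).
have -> : cons_const * S / (lam ^+ 2 * t k.+1 ^+ 2) =
    S / (lam ^+ 2 * t k ^+ 2) * (t k ^+ 2 / t k.+1 ^+ 2 * cons_const).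
  by field; rewrite !gt_eqF ?time_gt0.
rewrite ler_wpM2l // ler_wpM2r // ler_pdivlMr ?exprn_gt0 ?time_gt0 // time_succ.
have t4 := time_gt4 k.
have : 0 <= (lam * t k - 8) * (t k + 2) by rewrite mulr_ge0 //; std_lra.
by std_nra.
Qed.

(* [Z] is the scale of the terms in [1 / t^2], [y] and [b] those of the noise
   coming from [sigma] and from the gradients at the minimizer. *)
Let Z : R := S / (N * (1 - rho) ^+ 2).
Let y : R := N^-1.
Let b : R := B / N ^+ 2.

Definition cons_rate : R := 4 * cons_const.

Lemma cons_const_ge0 : 0 <= cons_const.
Proof.
have D1 := dist_const_ge1; have c0 := cons_source_ge0.
have q2 : 0 <= (minshift + 1) ^+ 2 by exact: sqr_ge0.
by rewrite /cons_const addr_ge0 // mulr_ge0 //; std_lra.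
Qed.

Lemma scale_gt0 : 0 < Z.
Proof.
case/andP: hrho => h0 h1; have S1 := total_ge1.
by rewrite /Z divr_gt0 ?mulr_gt0 ?exprn_gt0 ?subr_gt0 //; std_lra.
Qed.

Lemma scale_ge : S / N <= Z.
Proof.
case/andP: hrho => h0 h1; have S1 := total_ge1.
have N0 : 0 < N by std_lra.
rewrite /Z ler_wpM2l //; first by std_lra.
rewrite lef_pV2 ?posrE ?mulr_gt0 ?exprn_gt0 ?subr_gt0 //.
rewrite ger_pMr // exprn_ile1 //; std_lra.
Qed.

Lemma cons_bound k : v k / N <= cons_rate * Z / t k ^+ 2.
Proof.
case/andP: hrho => h0 h1; have S1 := total_ge1.
have N0 : 0 < N by std_lra.
have l0 := gap_gt0; have t0 := time_gt0 k.
rewrite ler_pdivrMr //; apply: (le_trans (cons_bound_gap k)).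
have -> : cons_rate * Z / t k ^+ 2 * N =
    cons_const * S / (((1 - rho) / 2) ^+ 2 * t k ^+ 2).
  by rewrite /cons_rate /Z; field; rewrite !gt_eqF ?subr_gt0.
have rho0 : 0 < (1 - rho) / 2 by std_lra.
rewrite ler_wpM2l //; first by rewrite mulr_ge0 ?cons_const_ge0 //; std_lra.
have pos x : 0 < x -> 0 < x ^+ 2 * t k ^+ 2.
  by move=> x0; rewrite mulr_gt0 ?exprn_gt0.
rewrite lef_pV2 ?posrE ?pos //.
rewrite ler_wpM2r ?sqr_ge0 // ler_sqr ?nnegrE; [exact: gap_ge|exact: ltW|exact: ltW].
Qed.

Hypothesis opt_rec : forall k delta eta, 0 < delta -> 0 < eta ->
  r k.+1 <= (1 - 2 * a k * mu + a k ^+ 2 * L ^+ 2 + a k * eta) * r k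
   + (a k * L ^+ 2 / eta + a k ^+ 2 * L ^+ 2) * (v k / N)
   + a k ^+ 2 * ((sigma ^+ 2 + (1 + delta) * M * B / N) / N
       + (1 + delta^-1) * M * L ^+ 2 / N * (r k + v k / N)).

(** Constants of the first, crude bound on the distance of the average to the
    minimizer. *)
Definition crude_eta : R := mu * (theta - 2) / (2 * theta).
Definition crude_noise : R := theta ^+ 2 / mu ^+ 2 * (sigma ^+ 2 + 2 * M).
Definition crude_cons : R := theta / mu * (L ^+ 2 / crude_eta + mu).
Definition crude_const : R :=
  2 * crude_cons * cons_rate / (theta - 2) + (minshift + 1) ^+ 2.

Lemma init_le : r 0%N <= (minshift + 1) ^+ 2 * Z / kap ^+ 2.
Proof.
have N0 : 0 < N by std_lra.
have Z0 := scale_gt0.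
have q0 : 0 < minshift by have := minshift_theta; std_lra.
have rZ : r 0%N <= Z.
  apply: le_trans scale_ge; rewrite ler_pdivlMr // mulrC.
  have := init; have := v_ge0 0; rewrite /H /S; std_lra.
apply: (le_trans rZ); rewrite -mulrA mulrCA ler_peMr ?(ltW Z0) //.
rewrite ler_pdivlMr ?mul1r ?exprn_gt0 //; last std_lra.
by rewrite ler_sqr ?nnegrE //; std_lra.
Qed.

Lemma cons_rate_ge0 : 0 <= cons_rate.
Proof. by have := cons_const_ge0; rewrite /cons_rate; lra. Qed.

Lemma inv_agents_gt0 : 0 < y. Proof. by rewrite /y invr_gt0; std_lra. Qed.
Lemma inv_agents_le1 : y <= 1. Proof. by rewrite /y invf_le1; std_lra. Qed.
Lemma dissim_ge0 : 0 <= b. Proof. by rewrite /b divr_ge0 // sqr_ge0. Qed.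

Lemma crude_eta_gt0 : 0 < crude_eta.
Proof. by rewrite /crude_eta divr_gt0 ?mulr_gt0 //; std_lra. Qed.

Lemma crude_cons_ge0 : 0 <= crude_cons.
Proof.
rewrite /crude_cons mulr_ge0 ?divr_ge0 //; try std_lra.
apply: addr_ge0; last exact: ltW.
exact: divr_ge0 (sqr_ge0 _) (ltW crude_eta_gt0).
Qed.

Lemma crude_noise_ge0 : 0 <= crude_noise.
Proof.
rewrite /crude_noise mulr_ge0 ?divr_ge0 ?sqr_ge0 //.
by have := sqr_ge0 sigma; std_lra.
Qed.

Lemma crude_const_ge0 : 0 <= crude_const.
Proof.
rewrite /crude_const addr_ge0 ?sqr_ge0 // divr_ge0 //; last std_lra.
apply: mulr_ge0 cons_rate_ge0; apply: mulr_ge0 crude_cons_ge0; std_lra.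
Qed.

(** The weights [delta = 1] and [eta = crude_eta] are chosen so that, after the
    terms quadratic in the step size have been absorbed, the contraction is
    still [1 - c / t] with [c = (theta + 2) / 2 > 2]. *)
Lemma opt_crude k :
  r k <= crude_noise * (y + b) / t k + crude_const * Z / t k ^+ 2.
Proof.
have Z0 := ltW scale_gt0; have y0 := inv_agents_gt0; have y1 := inv_agents_le1; have b0 := dissim_ge0.
have cr0 := cons_rate_ge0; have cc0 := crude_cons_ge0.
have cn0 := crude_noise_ge0; have e0 := crude_eta_gt0.
have th : 0 < theta - 2 by std_lra.
suff : r k <= crude_noise * (y + b) / (k%:R + kap) +
    0 / ((k%:R + kap) * Num.sqrt (k%:R + kap)) +
    crude_const * Z / (k%:R + kap) ^+ 2 by rewrite mul0r addr0 tE.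
have cC : 2 * crude_cons * cons_rate / (theta - 2) <= crude_const.
  by rewrite /crude_const lerDl sqr_ge0.
apply: (@decay_rate _ kap ((theta + 2) / 2)) => {k}.
- std_lra.
- by have := minshift_theta; std_lra.
- by rewrite mulr_ge0 //; std_lra.
- by [].
- by rewrite mulr_ge0 // crude_const_ge0.
- apply: (le_trans init_le); rewrite ler_wpM2r ?invr_ge0 ?sqr_ge0 //.
  rewrite ler_wpM2r // /crude_const lerDr divr_ge0 //; last std_lra.
  apply: mulr_ge0 cr0; apply: mulr_ge0 cc0; std_lra.
move=> k /=; rewrite -tE mulr0 mul0r addr0.
apply: (le_trans (opt_rec k ltr01 e0)).
have t0 := time_gt0 k; have a0 := step_gt0 k; have aL := step_smooth k.
have u0 : 0 <= a k * L ^+ 2 by rewrite mulr_ge0 ?sqr_ge0 // ltW.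
have vle := cons_bound k.
have w0 : 0 <= v k / N by rewrite divr_ge0 //; std_lra.
set w := v k / N in vle w0 *; set u := a k * L ^+ 2 in aL u0 *.
have uN : u + 2 * M * u * y <= mu.
  apply: le_trans aL.
  have : M * u * y <= M * u by rewrite ler_piMr // mulr_ge0 //; std_lra.
  std_lra.
rewrite invr1.
have -> : (1 - 2 * a k * mu + a k ^+ 2 * L ^+ 2 + a k * crude_eta) * r k +
   (u / crude_eta + a k ^+ 2 * L ^+ 2) * w +
   a k ^+ 2 * ((sigma ^+ 2 + (1 + 1) * M * B / N) / N +
      (1 + 1) * M * L ^+ 2 / N * (r k + w)) =
   (1 - 2 * (a k * mu) + a k * (u + 2 * M * u * y + crude_eta)) * r k +
   a k * (L ^+ 2 / crude_eta + (u + 2 * M * u * y)) * w +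
   a k ^+ 2 * (sigma ^+ 2 * y + 2 * M * b).
  by rewrite /u /y /b; field; rewrite !gt_eqF //; std_lra.
rewrite -[leLHS]addrA -[leRHS]addrA; apply: lerD.
  apply: ler_wpM2r => //.
  have -> : 1 - (theta + 2) / 2 / t k = 1 - 2 * (a k * mu) + a k * (mu + crude_eta).
    by rewrite aE /crude_eta; field; rewrite !gt_eqF //; std_lra.
  by rewrite lerD2l ler_wpM2l ?(ltW a0) // lerD2r.
rewrite [leLHS]addrC; apply: lerD.
  apply: (@le_trans _ _ (crude_noise * (y + b) / t k ^+ 2)); last first.
    rewrite ler_wpM2r ?invr_ge0 ?sqr_ge0 //.
    have p0 : 0 <= crude_noise * (y + b) by apply: mulr_ge0 cn0 _; std_lra.
    by rewrite ler_peMl //; std_lra.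
  have -> : crude_noise * (y + b) / t k ^+ 2 =
     a k ^+ 2 * ((sigma ^+ 2 + 2 * M) * (y + b)).
    by rewrite /crude_noise aE; field; rewrite !gt_eqF.
  rewrite ler_wpM2l ?sqr_ge0 //.
  have h1 := mulr_ge0 (sqr_ge0 sigma) b0.
  have h2 := mulr_ge0 (ltW hM) (ltW y0).
  by std_lra.
apply: (@le_trans _ _ (crude_cons * cons_rate * Z / t k ^+ 3)); last first.
  rewrite ler_wpM2r ?invr_ge0 ?exprn_ge0 ?(ltW t0) //.
  rewrite mulrA ler_wpM2r //.
  have -> : crude_cons * cons_rate = ((theta + 2) / 2 - 2) *
      (2 * crude_cons * cons_rate / (theta - 2)).
    by field; rewrite gt_eqF.
  by rewrite ler_wpM2l //; std_lra.
have -> : crude_cons * cons_rate * Z / t k ^+ 3 =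
   a k * (L ^+ 2 / crude_eta + mu) * (cons_rate * Z / t k ^+ 2).
  by rewrite /crude_cons aE; field; rewrite !gt_eqF.
apply: ler_pM => //.
  apply: mulr_ge0 (ltW a0) _; apply: addr_ge0 (divr_ge0 (sqr_ge0 _) (ltW e0)) _.
  by rewrite addr_ge0 // mulr_ge0 ?(ltW y0) // mulr_ge0 //; std_lra.
by rewrite ler_wpM2l ?(ltW a0) // lerD2l.
Qed.

(** [mix_eps] is the largest Young weight for which the share of [B] in the
    interaction of the two errors fits in [M / 2 * b]; [mix_const] and
    [high_const] are the resulting constants in front of [t^(-5/2)] and
    [t^(-3)]. *)
Definition mix_eps : R := theta * M / (2 * mu * crude_noise).
Definition mix_const : R := theta / mu * (crude_noise + L ^+ 2 * cons_rate).
Definition high_const : R :=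
  theta / mu * (mix_eps * crude_const + L ^+ 2 * cons_rate / mix_eps)
  + theta ^+ 2 * L ^+ 2 * (1 + 3 * M) / mu ^+ 2
      * (crude_noise + crude_const + cons_rate).

Let w : R := Num.sqrt (y * Z).
Let noise : R := theta ^+ 2 / mu ^+ 2 * (sigma ^+ 2 * y + 2 * M * b).

Lemma crude_noise_gt0 : 0 < crude_noise.
Proof.
rewrite /crude_noise mulr_gt0 ?divr_gt0 ?exprn_gt0 //; first by std_lra.
by have := sqr_ge0 sigma; std_lra.
Qed.

Lemma mix_eps_gt0 : 0 < mix_eps.
Proof.
apply: divr_gt0; first by apply: mulr_gt0; std_lra.
by apply: mulr_gt0 crude_noise_gt0; std_lra.
Qed.

Lemma noise_scale_le : y + b <= Z.
Proof.
apply: le_trans scale_ge; have N0 : 0 < N by std_lra.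
have -> : y + b = (N + B) / N / N.
  by rewrite /y /b; field; rewrite gt_eqF.
rewrite ler_wpM2r ?invr_ge0 ?(ltW N0) // ler_pdivrMr //.
have h := mulr_ge0 hA (ltW N0); have h' := mulr_ge0 hB (ltW N0).
have : 0 <= (N - 1) * (N + B) by rewrite mulr_ge0 //; std_lra.
by rewrite /S; std_lra.
Qed.

Lemma opt_crude_scale k : r k <= (crude_noise + crude_const) * Z / t k.
Proof.
have t0 := time_gt0 k; have cn0 := crude_noise_ge0; have cc0 := crude_const_ge0.
have Z0 := ltW scale_gt0.
apply: (le_trans (opt_crude k)).
rewrite [in leRHS]mulrDl [in leRHS]mulrDl; apply: lerD.
  by rewrite ler_wpM2r ?invr_ge0 ?(ltW t0) // ler_wpM2l // noise_scale_le.
have p0 : 0 <= crude_const * Z := mulr_ge0 cc0 Z0.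
rewrite ler_wpM2l // lef_pV2 ?posrE ?exprn_gt0 // expr2 ler_peMr ?(ltW t0) //.
by have := time_gt4 k; lra.
Qed.

Lemma high_order k :
  a k ^+ 2 * L ^+ 2 * (1 + 3 * M * y) * (r k + v k / N) <=
  theta ^+ 2 * L ^+ 2 * (1 + 3 * M) / mu ^+ 2
      * (crude_noise + crude_const + cons_rate) * Z / t k ^+ 3.
Proof.
have t0 := time_gt0 k; have cr0 := cons_rate_ge0.
have Z0 := ltW scale_gt0; have y0 := ltW inv_agents_gt0; have y1 := inv_agents_le1.
have -> : theta ^+ 2 * L ^+ 2 * (1 + 3 * M) / mu ^+ 2
      * (crude_noise + crude_const + cons_rate) * Z / t k ^+ 3 =
   a k ^+ 2 * L ^+ 2 * (1 + 3 * M) *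
   ((crude_noise + crude_const) * Z / t k + cons_rate * Z / t k).
  by rewrite aE; field; rewrite !gt_eqF.
have aL0 : 0 <= a k ^+ 2 * L ^+ 2 := mulr_ge0 (sqr_ge0 _) (sqr_ge0 _).
have My : M * y <= M by rewrite ler_piMr //; std_lra.
have My0 : 0 <= M * y by rewrite mulr_ge0 //; std_lra.
apply: ler_pM.
- by apply: mulr_ge0 => //; std_lra.
- by apply: addr_ge0 => //; rewrite divr_ge0 //; std_lra.
- by rewrite ler_wpM2l //; std_lra.
apply: lerD (opt_crude_scale k) _; apply: (le_trans (cons_bound k)).
have p0 : 0 <= cons_rate * Z := mulr_ge0 cr0 Z0.
rewrite ler_wpM2l // lef_pV2 ?posrE ?exprn_gt0 // expr2 ler_peMr ?(ltW t0) //.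
by have := time_gt4 k; lra.
Qed.

(** The interaction of the optimisation and consensus errors, bounded through
    [opt_crude].  It has three parts: one for [B], small enough to be hidden in
    the noise term, one for [sigma], which is the genuine [t^(-5/2)] term, and a
    higher order one. *)
Lemma cross_term k : exists2 eta, 0 < eta &
  a k * (eta * r k + L ^+ 2 / eta * (v k / N)) <=
  theta ^+ 2 / mu ^+ 2 * (M / 2 * b) / t k ^+ 2
  + mix_const * w / (t k ^+ 2 * Num.sqrt (t k))
  + theta / mu * (mix_eps * crude_const + L ^+ 2 * cons_rate / mix_eps)
      * Z / t k ^+ 3.
Proof.
have t0 := time_gt0 k; have Z0 := scale_gt0; have y0 := inv_agents_gt0; have b0 := dissim_ge0.
have w0 : 0 < w by rewrite sqrtr_gt0 mulr_gt0.
have s0 : 0 < Num.sqrt (t k) by rewrite sqrtr_gt0.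
have e0 := mix_eps_gt0; have cn0 := crude_noise_gt0.
have cc0 := crude_const_ge0; have cr0 := cons_rate_ge0.
pose etay := w / (y * Num.sqrt (t k)).
have ey0 : 0 < etay by rewrite divr_gt0 // mulr_gt0.
(* [etay] balances the two halves of the term in [t^(-3/2)]; the cap [mix_eps]
   keeps the contribution of [b] below the slack [M / 2 * b]. *)
pose eta := Num.min etay mix_eps.
have eta0 : 0 < eta by rewrite /eta lt_min ey0.
have ety : eta <= etay by rewrite /eta ge_min lexx.
have ete : eta <= mix_eps by rewrite /eta ge_min lexx orbT.
have ieta : eta^-1 <= etay^-1 + mix_eps^-1.
  rewrite /eta; case: (leP etay mix_eps) => _; [rewrite lerDl|rewrite lerDr];
    by rewrite invr_ge0 ltW.
exists eta => //.
have wE : w ^+ 2 = y * Z by rewrite sqr_sqrtr // mulr_ge0 ?ltW.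
have sE : Num.sqrt (t k) ^+ 2 = t k by rewrite sqr_sqrtr // ltW.
set s := Num.sqrt (t k) in s0 sE etay ey0 eta eta0 ety ete ieta *.
have h1 : eta * r k <= crude_noise * (w / (t k * s)) +
    mix_eps * crude_noise * b / t k + mix_eps * crude_const * Z / t k ^+ 2.
  apply: (le_trans (ler_wpM2l (ltW eta0) (opt_crude k))).
  rewrite mulrDr; apply: lerD.
    have -> : crude_noise * (w / (t k * s)) = crude_noise * (etay * y / t k).
      by rewrite /etay; field; rewrite !gt_eqF.
    have -> : eta * (crude_noise * (y + b) / t k) =
      crude_noise * (eta * y / t k) + eta * (crude_noise * b / t k).
      by field; rewrite gt_eqF.
    apply: lerD.
      apply: (ler_wpM2l (ltW cn0)).
      by rewrite ler_wpM2r ?invr_ge0 ?(ltW t0) // ler_wpM2r // ltW.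
    have -> : mix_eps * crude_noise * b / t k = mix_eps * (crude_noise * b / t k).
      by rewrite !mulrA.
    apply: ler_wpM2r => //.
    exact: divr_ge0 (mulr_ge0 (ltW cn0) b0) (ltW t0).
  have -> : mix_eps * crude_const * Z / t k ^+ 2 =
      mix_eps * (crude_const * Z / t k ^+ 2) by rewrite !mulrA.
  apply: ler_wpM2r => //.
  exact: divr_ge0 (mulr_ge0 cc0 (ltW Z0)) (sqr_ge0 _).
have h2 : L ^+ 2 / eta * (v k / N) <= L ^+ 2 * cons_rate * (w / (t k * s)) +
    L ^+ 2 * cons_rate / mix_eps * Z / t k ^+ 2.
  have -> : L ^+ 2 * cons_rate * (w / (t k * s)) +
     L ^+ 2 * cons_rate / mix_eps * Z / t k ^+ 2 =
     L ^+ 2 * (etay^-1 + mix_eps^-1) * (cons_rate * Z / t k ^+ 2).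
    have -> : Z = w ^+ 2 / y by rewrite wE mulrC mulKf // gt_eqF.
    by rewrite /etay -sE; field; rewrite !gt_eqF.
  apply: ler_pM; last exact: cons_bound.
  - by rewrite divr_ge0 ?sqr_ge0 // ltW.
  - by rewrite divr_ge0 //; std_lra.
  - by rewrite ler_wpM2l ?sqr_ge0.
apply: (le_trans (ler_wpM2l (ltW (step_gt0 k)) (lerD h1 h2))).
rewrite le_eqVlt; apply/orP; left; apply/eqP.
rewrite aE /mix_const.
have -> : theta ^+ 2 / mu ^+ 2 * (M / 2 * b) / t k ^+ 2 =
   theta / (mu * t k) * (mix_eps * crude_noise * b / t k).
  by rewrite /mix_eps; field; rewrite !gt_eqF.
by field; rewrite !gt_eqF.
Qed.

Lemma opt_refined k : r k.+1 <= (1 - 2 * theta / t k) * r k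
   + noise / t k ^+ 2 + mix_const * w / (t k ^+ 2 * Num.sqrt (t k))
   + high_const * Z / t k ^+ 3.
Proof.
have t0 := time_gt0 k; have N0 : 0 < N by std_lra.
(* [delta = 1/2] leaves [M / 2 * b] of the noise term free for [cross_term]. *)
have d0 : 0 < 2^-1 :> R by rewrite invr_gt0.
have [eta e0 cross] := cross_term k.
apply: (le_trans (opt_rec k d0 e0)).
have -> : (1 - 2 * a k * mu + a k ^+ 2 * L ^+ 2 + a k * eta) * r k +
   (a k * L ^+ 2 / eta + a k ^+ 2 * L ^+ 2) * (v k / N) +
   a k ^+ 2 * ((sigma ^+ 2 + (1 + 2^-1) * M * B / N) / N +
       (1 + 2^-1^-1) * M * L ^+ 2 / N * (r k + v k / N)) =
   (1 - 2 * (a k * mu)) * r k + a k ^+ 2 * (sigma ^+ 2 * y + 3 / 2 * M * b)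
   + a k * (eta * r k + L ^+ 2 / eta * (v k / N))
   + a k ^+ 2 * L ^+ 2 * (1 + 3 * M * y) * (r k + v k / N).
  by rewrite /y /b; field; rewrite !gt_eqF.
apply: (le_trans (lerD (lerD (lexx _) cross) (high_order k))).
rewrite le_eqVlt; apply/orP; left; apply/eqP.
rewrite step_mu /high_const aE /noise.
have s0 : 0 < Num.sqrt (t k) by rewrite sqrtr_gt0.
set c1 := mix_eps * crude_const + _; set s := Num.sqrt (t k) in s0 *.
by field; rewrite !gt_eqF.
Qed.

Definition mse_const : R := high_const + (minshift + 1) ^+ 2 + cons_rate.

Lemma mix_const_ge0 : 0 <= mix_const.
Proof.
have cn0 := crude_noise_ge0; have := mulr_ge0 (sqr_ge0 L) cons_rate_ge0 => h.
by rewrite /mix_const mulr_ge0 ?divr_ge0 //; std_lra.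
Qed.

Lemma high_const_ge0 : 0 <= high_const.
Proof.
have e0 := ltW mix_eps_gt0; have cn0 := crude_noise_ge0.
have cc0 := crude_const_ge0; have cr0 := cons_rate_ge0.
have L2 := sqr_ge0 L.
apply: addr_ge0; apply: mulr_ge0.
- by rewrite divr_ge0 //; std_lra.
- exact: addr_ge0 (mulr_ge0 e0 cc0) (divr_ge0 (mulr_ge0 L2 cr0) e0).
- apply: divr_ge0 (sqr_ge0 _); apply: mulr_ge0; last std_lra.
  exact: mulr_ge0 (sqr_ge0 _) L2.
- by std_lra.
Qed.

(** By [decay_rate] with [c = 2 * theta]; the factor [2 * theta - 1] of the
    leading term is the margin of that contraction over the decay of [1 / t]. *)
Lemma mse_bound k : r k + v k / N <=
  noise / (2 * theta - 1) / t k + mix_const * w / (t k * Num.sqrt (t k))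
  + mse_const * Z / t k ^+ 2.
Proof.
have Z0 := ltW scale_gt0; have hc0 := high_const_ge0; have mc0 := mix_const_ge0.
have w0 : 0 <= w := sqrtr_ge0 _.
have t2 : 0 < 2 * theta - 1 by std_lra.
have n0 : 0 <= noise.
  have h := mulr_ge0 (sqr_ge0 sigma) (ltW inv_agents_gt0).
  have h' := mulr_ge0 (ltW hM) dissim_ge0.
  apply: mulr_ge0; first by rewrite divr_ge0 ?sqr_ge0.
  by std_lra.
suff rk : r k <= noise / (2 * theta - 1) / t k
    + mix_const * w / (t k * Num.sqrt (t k))
    + (high_const + (minshift + 1) ^+ 2) * Z / t k ^+ 2.
  apply: (le_trans (lerD rk (cons_bound k))).
  by rewrite -addrA lerD2l /mse_const [in leRHS]mulrDl [in leRHS]mulrDl.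
rewrite tE; apply: (@decay_rate _ kap (2 * theta)) => {k}.
- by std_lra.
- by have := minshift_theta; std_lra.
- by rewrite divr_ge0 // ltW.
- exact: mulr_ge0.
- by rewrite mulr_ge0 // addr_ge0 // sqr_ge0.
- apply: (le_trans init_le); rewrite ler_wpM2r ?invr_ge0 ?sqr_ge0 //.
  by rewrite ler_wpM2r // lerDr.
move=> k /=; rewrite -tE; apply: (le_trans (opt_refined k)).
have t0 := time_gt0 k.
have s0 : 0 < Num.sqrt (t k) by rewrite sqrtr_gt0.
apply: lerD; first apply: lerD.
- by rewrite mulrCA divff ?gt_eqF // mulr1.
- apply: ler_wpM2r; first by rewrite invr_ge0 mulr_ge0 ?sqr_ge0 // ltW.
  by rewrite ler_peMl ?(mulr_ge0 mc0 w0) //; std_lra.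
- apply: ler_wpM2r; first by rewrite invr_ge0 exprn_ge0 // ltW.
  rewrite mulrA; apply: ler_wpM2r => //.
  have q2 := sqr_ge0 (minshift + 1).
  apply: (@le_trans _ _ (high_const + (minshift + 1) ^+ 2)); first by std_lra.
  by rewrite ler_peMl ?(addr_ge0 hc0 q2) //; std_lra.
Qed.

End recursions.

(** * Euclidean geometry *)

Section inner_product.
Context {R : realType} {p : nat}.
Implicit Types (u v w : 'rV[R]_p) (a : R).

Lemma dotpC u v : dotp u v = dotp v u.
Proof. by apply: eq_bigr => j _; rewrite mulrC. Qed.

Lemma dotpDl u v w : dotp (u + v) w = dotp u w + dotp v w.
Proof. by rewrite -big_split; apply: eq_bigr => j _; rewrite mxE mulrDl. Qed.

Lemma dotpZl a u w : dotp (a *: u) w = a * dotp u w.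
Proof. by rewrite mulr_sumr; apply: eq_bigr => j _; rewrite mxE mulrA. Qed.

Lemma dotpNl u w : dotp (- u) w = - dotp u w.
Proof. by rewrite -scaleN1r dotpZl mulN1r. Qed.

Lemma dotpDr u v w : dotp w (u + v) = dotp w u + dotp w v.
Proof. by rewrite dotpC dotpDl !(dotpC w). Qed.

Lemma dotpZr a u w : dotp w (a *: u) = a * dotp w u.
Proof. by rewrite dotpC dotpZl (dotpC w). Qed.

Lemma dotpNr u w : dotp w (- u) = - dotp w u.
Proof. by rewrite dotpC dotpNl (dotpC w). Qed.

Definition dotpE := (dotpDl, dotpDr, dotpNl, dotpNr, dotpZl, dotpZr).

Lemma dotp_suml n (F : 'I_n -> 'rV[R]_p) w :
  dotp (\sum_i F i) w = \sum_i dotp (F i) w.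
Proof.
rewrite /dotp exchange_big /=; apply: eq_bigr => j _.
by rewrite summxE mulr_suml.
Qed.

Lemma sqnorm_ge0 u : 0 <= sqnorm u.
Proof. by apply: sumr_ge0 => j _; exact: sqr_ge0. Qed.

Lemma sqnorm0 : sqnorm (0 : 'rV[R]_p) = 0.
Proof. by rewrite /sqnorm -(scale0r 0) dotpZl mul0r. Qed.

Lemma sqnormZ a u : sqnorm (a *: u) = a ^+ 2 * sqnorm u.
Proof. by rewrite /sqnorm !dotpE mulrA. Qed.

Lemma sqnormD u v : sqnorm (u + v) = sqnorm u + 2 * dotp u v + sqnorm v.
Proof. by rewrite /sqnorm !dotpE (dotpC v); ring. Qed.

Lemma sqnormB u v : sqnorm (u - v) = sqnorm u - 2 * dotp u v + sqnorm v.
Proof. by rewrite /sqnorm !dotpE (dotpC v); ring. Qed.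

Lemma sqnormN u : sqnorm (- u) = sqnorm u.
Proof. by rewrite /sqnorm !dotpE opprK. Qed.

Lemma young_dotp eta u v : 0 < eta ->
  2 * dotp u v <= eta * sqnorm u + eta^-1 * sqnorm v.
Proof.
move=> e0; have := sqnorm_ge0 (eta *: u - v).
rewrite sqnormB sqnormZ dotpZl => h.
rewrite -(ler_pM2l e0) mulrDr mulVKf ?gt_eqF //; lra.
Qed.

Lemma young_sqnorm delta u v : 0 < delta ->
  sqnorm (u + v) <= (1 + delta) * sqnorm u + (1 + delta^-1) * sqnorm v.
Proof. by move=> d0; have := young_dotp u v d0; rewrite sqnormD; lra. Qed.

Lemma sqnorm_norm2 u : norm2 u ^+ 2 = sqnorm u.
Proof. by rewrite sqr_sqrtr // sqnorm_ge0. Qed.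

Lemma norm2_ge0 u : 0 <= norm2 u. Proof. exact: sqrtr_ge0. Qed.

Lemma le_norm2 c u v : 0 <= c -> norm2 v <= c * norm2 u ->
  sqnorm v <= c ^+ 2 * sqnorm u.
Proof.
move=> c0 h; rewrite -!sqnorm_norm2 -exprMn.
by rewrite ler_sqr ?nnegrE ?norm2_ge0 // mulr_ge0 ?norm2_ge0.
Qed.

Lemma dotp_sqr_le u v : dotp u v ^+ 2 <= sqnorm u * sqnorm v.
Proof.
have [/eqP u0|u0] := eqVneq (sqnorm u) 0.
  suff -> : dotp u v = 0 by rewrite expr2 mul0r mulr_ge0 ?sqnorm_ge0.
  apply: big1 => j _; suff -> : u 0 j = 0 by rewrite mul0r.
  move: u0; rewrite /sqnorm /dotp psumr_eq0 => [/allP /(_ j)|i _]; last exact: sqr_ge0.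
  by rewrite mem_index_enum => /(_ isT); rewrite mulf_eq0 orbb => /eqP.
have up : 0 < sqnorm u by rewrite lt_neqAle eq_sym u0 sqnorm_ge0.
(* the component of [v] orthogonal to [u], scaled by [sqnorm u] *)
have := sqnorm_ge0 (sqnorm u *: v - dotp u v *: u).
rewrite sqnormB !sqnormZ !dotpE (dotpC v) => h.
rewrite -subr_ge0 -(pmulr_rge0 _ up); apply: le_trans h _.
by rewrite le_eqVlt; apply/orP; left; apply/eqP; ring.
Qed.

(** Jensen's inequality: the defect is the variance of the [u i]. *)
Lemma sqnorm_convex n (c : 'I_n -> R) (u : 'I_n -> 'rV[R]_p) :
  (forall i, 0 <= c i) -> \sum_i c i = 1 ->
  sqnorm (\sum_i c i *: u i) <= \sum_i c i * sqnorm (u i).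
Proof.
move=> c0 c1; set m := \sum_i _.
rewrite -subr_ge0.
have -> : \sum_i c i * sqnorm (u i) - sqnorm m =
    \sum_i c i * sqnorm (u i - m).
  under [RHS]eq_bigr do rewrite sqnormB mulrDr mulrBr.
  rewrite big_split sumrB /= -mulr_suml c1 mul1r.
  have -> : \sum_i c i * (2 * dotp (u i) m) = 2 * sqnorm m.
    rewrite /sqnorm {2}/m dotp_suml mulr_sumr; apply: eq_bigr => i _.
    by rewrite dotpZl; ring.
  by ring.
by apply: sumr_ge0 => i _; rewrite mulr_ge0 ?sqnorm_ge0.
Qed.

End inner_product.

Section spectral.
Context {R : realType} {n : nat}.
Implicit Types (A : 'M[R]_n) (v : 'rV[R]_n).

Lemma sqnorm_mulmx_le A v :
  sqnorm (v *m A^T) <= (\sum_i sqnorm (row i A)) * sqnorm v.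
Proof.
rewrite mulr_suml; apply: ler_sum => i _.
have -> : (v *m A^T) 0 i = dotp (row i A) v.
  by rewrite mxE; apply: eq_bigr => j _; rewrite !mxE mulrC.
exact: dotp_sqr_le.
Qed.

(** The Frobenius norm bounds the set; otherwise its supremum would carry no
    information. *)
Lemma spectral_has_ubound A :
  has_ubound [set norm2 (v *m A^T) | v in [set v : 'rV[R]_n | norm2 v <= 1]].
Proof.
exists (Num.sqrt (\sum_i sqnorm (row i A))) => _ [v /= v1 <-].
rewrite ler_wsqrtr //; apply: (le_trans (sqnorm_mulmx_le A v)).
rewrite ler_piMr ?sumr_ge0 // => [i _|]; first exact: sqnorm_ge0.
by rewrite -sqnorm_norm2 exprn_ile1 ?norm2_ge0.
Qed.

Lemma spectral_norm_ge0 A : 0 <= spectral_norm A.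
Proof.
apply: (@le_trans _ _ (norm2 (0 *m A^T))); first exact: norm2_ge0.
apply: ub_le_sup; first exact: spectral_has_ubound.
by exists 0 => //=; rewrite /norm2 sqnorm0 sqrtr0.
Qed.

Lemma spectral_norm_le A v :
  sqnorm (v *m A^T) <= spectral_norm A ^+ 2 * sqnorm v.
Proof.
apply: le_norm2; first exact: spectral_norm_ge0.
have [v0|v0] := eqVneq (norm2 v) 0.
  rewrite v0 mulr0 /norm2.
  suff -> : sqnorm (v *m A^T) = 0 by rewrite sqrtr0.
  apply/eqP; rewrite eq_le sqnorm_ge0 andbT.
  apply: (le_trans (sqnorm_mulmx_le A v)).
  by rewrite -(sqnorm_norm2 v) v0 expr2 mulr0 mulr0.
have vp : 0 < norm2 v by rewrite lt_neqAle eq_sym v0 norm2_ge0.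
have nZ (w : 'rV[R]_n) : norm2 ((norm2 v)^-1 *: w) = (norm2 v)^-1 * norm2 w.
  rewrite /norm2 sqnormZ sqrtrM ?sqr_ge0 // sqrtr_sqr gtr0_norm //.
  by rewrite invr_gt0.
rewrite -ler_pdivrMr // mulrC -nZ scalemxAl.
apply: ub_le_sup; first exact: spectral_has_ubound.
by exists ((norm2 v)^-1 *: v) => //=; rewrite nZ mulVf.
Qed.

(** The squared norms add up over the coordinates of the signal, and on each
    coordinate the spectral norm applies. *)
Lemma spectral_norm_mix p A (y : 'I_n -> 'rV[R]_p) :
  \sum_i sqnorm (\sum_j A i j *: y j) <=
  spectral_norm A ^+ 2 * \sum_j sqnorm (y j).
Proof.
pose col c : 'rV[R]_n := \row_j y j 0 c.
have -> : \sum_j sqnorm (y j) = \sum_c sqnorm (col c).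
  by rewrite exchange_big; do 2 apply: eq_bigr => ? _; rewrite !mxE.
have -> : \sum_i sqnorm (\sum_j A i j *: y j) = \sum_c sqnorm (col c *m A^T).
  rewrite exchange_big; do 2 apply: eq_bigr => ? _; rewrite !mxE summxE.
  by congr (_ * _); apply: eq_bigr => k _; rewrite !mxE mulrC.
by rewrite mulr_sumr; apply: ler_sum => c _; exact: spectral_norm_le.
Qed.

End spectral.

Section mean.
Context {R : realType} {n p : nat}.
Hypothesis hn : (0 < n)%N.
Implicit Types (u x y : 'I_n -> 'rV[R]_p) (z : 'rV[R]_p).

Definition mean u : 'rV[R]_p := n%:R^-1 *: \sum_i u i.

Lemma agents_neq0 : n%:R != 0 :> R. Proof. by rewrite pnatr_eq0 -lt0n. Qed.

Lemma agents_gt0 : 0 < n%:R :> R. Proof. by rewrite ltr0n. Qed.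

Lemma sum_mean u : \sum_i u i = n%:R *: mean u.
Proof. by rewrite /mean scalerA divff ?agents_neq0 // scale1r. Qed.

Lemma meanD u y : mean (fun i => u i + y i) = mean u + mean y.
Proof. by rewrite /mean big_split scalerDr. Qed.

Lemma meanZ a u : mean (fun i => a *: u i) = a *: mean u.
Proof. by rewrite /mean -scaler_sumr !scalerA mulrC. Qed.

Lemma meanN u : mean (fun i => - u i) = - mean u.
Proof. by rewrite /mean sumrN scalerN. Qed.

Lemma meanB u y : mean (fun i => u i - y i) = mean u - mean y.
Proof. by rewrite meanD meanN. Qed.

Lemma sqnorm_mean_le u : sqnorm (mean u) <= n%:R^-1 * \sum_i sqnorm (u i).
Proof.
rewrite /mean scaler_sumr mulr_sumr; apply: sqnorm_convex => [i|].
  by rewrite invr_ge0.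
by rewrite sumr_const card_ord -[_^-1 *+ n]mulr_natr mulVf ?agents_neq0.
Qed.

(** The deviations from the mean sum to zero, so the cross terms cancel. *)
Lemma bias_variance u z : \sum_i sqnorm (u i - z) =
  n%:R * sqnorm (mean u - z) + \sum_i sqnorm (u i - mean u).
Proof.
under eq_bigr => i _ do rewrite -(subrK (mean u) (u i)) -addrA sqnormD.
rewrite 2!big_split /= sumr_const card_ord -[sqnorm _ *+ n]mulr_natl.
suff -> : \sum_i 2 * dotp (u i - mean u) (mean u - z) = 0.
  by rewrite addr0 addrC.
rewrite -mulr_sumr -dotp_suml.
rewrite sumrB sum_mean sumr_const card_ord -[mean u *+ n]scaler_nat subrr.
by rewrite -(scale0r 0) dotpZl mul0r mulr0.
Qed.

End mean.

(** * Mixing and gradient steps *)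

Section mixing.
Context {R : realType} {n p : nat} (E : rel 'I_n) (W : 'M[R]_n).
Hypotheses (hn : (0 < n)%N) (hW : mixing_matrix E W).
Implicit Types (u : 'I_n -> 'rV[R]_p) (z : 'rV[R]_p).

Definition mix u (i : 'I_n) : 'rV[R]_p := \sum_j W i j *: u j.

Lemma mixing_ge0 i j : 0 <= W i j. Proof. by case: hW. Qed.

Lemma mixing_row i : \sum_j W i j = 1.
Proof.
case: hW => _ _ _ /matrixP /(_ i 0) h _; move: h; rewrite !mxE => <-.
by apply: eq_bigr => j _; rewrite !mxE mulr1.
Qed.

Lemma mixing_col j : \sum_i W i j = 1.
Proof.
case: hW => _ _ _ _ /matrixP /(_ 0 j) h; move: h; rewrite !mxE => <-.
by apply: eq_bigr => i _; rewrite !mxE mul1r.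
Qed.

Lemma mean_mix u : mean (mix u) = mean u.
Proof.
rewrite /mean /mix exchange_big /=; congr (_ *: _).
by apply: eq_bigr => j _; rewrite -scaler_suml mixing_col scale1r.
Qed.

Lemma mix_subr u z i : mix u i - z = mix (fun j => u j - z) i.
Proof.
rewrite /mix; under [RHS]eq_bigr do rewrite scalerBr.
by rewrite sumrB -scaler_suml mixing_row scale1r.
Qed.

(** Convexity along the rows of [W], then exchange of sums along its columns. *)
Lemma mix_dist u z : \sum_i sqnorm (mix u i - z) <= \sum_j sqnorm (u j - z).
Proof.
have -> : \sum_j sqnorm (u j - z) = \sum_i \sum_j W i j * sqnorm (u j - z).
  by rewrite [RHS]exchange_big; apply: eq_bigr => j _; rewrite -mulr_suml mixing_col mul1r.
apply: ler_sum => i _; rewrite mix_subr.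
exact: sqnorm_convex (mixing_ge0 i) (mixing_row i).
Qed.

(** [W - 1 1^T / n] annihilates constant signals, so any reference point [z]
    may be subtracted before it acts. *)
Lemma mix_consensus u z : \sum_i sqnorm (mix u i - mean (mix u)) <=
  rho_w W ^+ 2 * \sum_j sqnorm (u j - z).
Proof.
apply: le_trans (spectral_norm_mix (W - n%:R^-1 *: const_mx 1) (fun j => u j - z)).
rewrite le_eqVlt; apply/orP; left; apply/eqP; apply: eq_bigr => i _.
congr sqnorm; rewrite mean_mix.
have -> : mix u i - mean u = (mix u i - z) - (mean u - z) by rewrite opprB subrKA.
rewrite mix_subr.
under [RHS]eq_bigr do rewrite !mxE mulr1 scalerBl.
rewrite sumrB -scaler_sumr; congr (_ - _).
rewrite sumrB scalerBr sumr_const card_ord.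
by rewrite -[z *+ n]scaler_nat scalerA mulVf ?agents_neq0 // scale1r.
Qed.

End mixing.

Section gradients.
Context {R : realType} {n p : nat} (mu L : R) (f : 'I_n -> 'rV[R]_p -> R).
Hypotheses (hn : (0 < n)%N) (hmu : 0 < mu) (hL : 0 < L).
Hypothesis hf : forall i, strongly_convex_smooth mu L (f i).

Lemma gradient_monotone i x y : mu * sqnorm (x - y) <=
  dotp (gradient (f i) x - gradient (f i) y) (x - y).
Proof. by case: (hf i). Qed.

Lemma gradient_lipschitz i x y :
  sqnorm (gradient (f i) x - gradient (f i) y) <= L ^+ 2 * sqnorm (x - y).
Proof. by apply: le_norm2; [exact: ltW|case: (hf i)]. Qed.

(** Fermat's rule along the line through [x] directed by [v]. *)
Lemma derive_minimizer (F : 'rV[R]_p -> R^o) (x v : 'rV[R]_p) :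
  (forall y, differentiable F y) -> (forall y, F x <= F y) -> 'D_v F x = 0.
Proof.
move=> dF minF; pose phi (h : R) : R^o := F (h *: v + x).
have -> : 'D_v F x = 'D_1 phi 0.
  rewrite /derive; set g1 := fun h => h^-1 *: _; set g2 := fun h => h^-1 *: _.
  suff -> : g1 = g2 by [].
  by rewrite funeqE /g1 /g2 => h /=; rewrite /phi /= addr0 scale0r add0r [_%:A]mulr1.
have dphi t : derivable phi t 1.
  apply/derivable1_diffP; rewrite (_ : phi = F \o (fun h : R => h *: v + x)) //.
  by apply: differentiable_comp.
have le_n11 : -1 <= 1 :> R by lra.
have z01 : 0 \in `](-1 : R), 1[ by rewrite in_itv /=; apply/andP; split; lra.
have -> := @derive_val _ _ _ _ _ _ _
  (@derive1_at_min R phi (-1) 1 0 le_n11 (fun t _ => dphi t) z01 _) => //.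
by move=> t _; rewrite /phi scale0r add0r.
Qed.

Lemma sum_gradient_minimizer x :
  is_minimizer (average f) x -> \sum_i gradient (f i) x = 0.
Proof.
move=> minx; apply/rowP => j; rewrite summxE mxE.
under eq_bigr do rewrite mxE.
have dfi i y : differentiable (f i : 'rV[R]_p -> R^o) y by case: (hf i).
rewrite -derive_sum => [|i]; last exact: diff_derivable.
apply: derive_minimizer => y.
  by apply: differentiable_sum.
rewrite !fct_sumE; have := minx y.
by rewrite /average ler_pM2l // invr_gt0 ltr0n.
Qed.

Lemma gradient_growth i x z delta : 0 < delta ->
  sqnorm (gradient (f i) x) <=
  (1 + delta) * sqnorm (gradient (f i) z)
    + (1 + delta^-1) * (L ^+ 2 * sqnorm (x - z)).
Proof.
move=> d0; have -> : gradient (f i) x =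
    gradient (f i) z + (gradient (f i) x - gradient (f i) z) by rewrite addrC subrK.
apply: (le_trans (young_sqnorm _ _ d0)); rewrite lerD2l ler_wpM2l //.
  by rewrite addr_ge0 // invr_ge0 ltW.
exact: gradient_lipschitz.
Qed.

(** The term in [M] accounts for the part of the noise variance proportional to
    the gradient.  Strong monotonicity yields [- 2 a mu]; half of [a mu] is spent
    on [gradient (f i) z], which is nonzero in general, and [a mu] on the terms
    quadratic in the step size. *)
Lemma agent_descent a M i x z : 0 <= a -> 0 <= M ->
  2 * (1 + M) * (a * L ^+ 2) <= mu ->
  sqnorm (x - z - a *: gradient (f i) x) + a ^+ 2 * M * sqnorm (gradient (f i) x)
  <= (1 - a * mu / 2) * sqnorm (x - z)
     + a * (2 / mu + 2 * a * (1 + M)) * sqnorm (gradient (f i) z).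
Proof.
move=> a0 M0 aL; rewrite sqnormB sqnormZ dotpZr.
have mono := gradient_monotone i x z.
have grow := gradient_growth i x z ltr01.
have mu2 : 0 < 2 / mu by rewrite divr_gt0.
have young := young_dotp (- gradient (f i) z) (x - z) mu2.
rewrite dotpDl dotpNl dotpC in mono; rewrite dotpNl sqnormN invf_div in young.
set d := dotp (x - z) (gradient (f i) x) in mono *.
set e := dotp (gradient (f i) z) (x - z) in mono young.
have s0 := sqnorm_ge0 (x - z).
set s := sqnorm (x - z) in mono grow young s0 *.
set g := sqnorm (gradient (f i) x) in grow *.
set h := sqnorm (gradient (f i) z) in grow young *.
have h1 : - (2 * d) <= 2 / mu * h + mu / 2 * s - 2 * (mu * s) by lra.
have := ler_wpM2l a0 h1.
have aM : 0 <= a ^+ 2 * (1 + M) by rewrite mulr_ge0 ?sqr_ge0 //; lra.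
rewrite invr1 in grow.
have := ler_wpM2l aM grow.
have := ler_wpM2l (mulr_ge0 a0 s0) aL.
have mN : mu != 0 by rewrite gt_eqF.
set A := 2 / mu; lra.
Qed.

(** The direction [mean (fun i => gradient (f i) (x i))] differs from the
    gradient of the average objective at [mean x] by an error that the Lipschitz
    condition bounds by the dispersion of the agents; [eta] weighs the
    interaction between the two. *)
Lemma mean_descent a eta (x : 'I_n -> 'rV[R]_p) z :
  \sum_i gradient (f i) z = 0 -> 0 <= a -> 0 < eta -> a * L ^+ 2 <= 2 * mu ->
  sqnorm (mean x - z - a *: mean (fun i => gradient (f i) (x i))) <=
  (1 - 2 * a * mu + a ^+ 2 * L ^+ 2 + a * eta) * sqnorm (mean x - z)
  + (a * L ^+ 2 / eta + a ^+ 2 * L ^+ 2)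
      * (n%:R^-1 * \sum_i sqnorm (x i - mean x)).
Proof.
move=> gz a0 e0 aL; set m := mean x.
pose gm := mean (fun i => gradient (f i) m).
pose e := mean (fun i => gradient (f i) m - gradient (f i) (x i)).
have n0 := agents_gt0 (R := R) hn.
have in0 : 0 <= n%:R^-1 :> R by rewrite invr_ge0.
have -> : mean (fun i => gradient (f i) (x i)) = gm - e.
  by rewrite /e meanB opprB addrC subrK.
have gmE : gm = mean (fun i => gradient (f i) m - gradient (f i) z).
  by rewrite meanB {2}/mean gz scaler0 subr0.
have mono : mu * sqnorm (m - z) <= dotp gm (m - z).
  rewrite gmE /mean dotpZl dotp_suml ler_pdivlMl //.
  have -> : n%:R * (mu * sqnorm (m - z)) = \sum_(i < n) mu * sqnorm (m - z).
    by rewrite sumr_const card_ord mulr_natl.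
  by apply: ler_sum => i _; exact: gradient_monotone.
have lip : sqnorm gm <= L ^+ 2 * sqnorm (m - z).
  rewrite gmE; apply: (le_trans (sqnorm_mean_le hn _)).
  rewrite ler_pdivrMl //.
  have -> : n%:R * (L ^+ 2 * sqnorm (m - z)) =
      \sum_(i < n) L ^+ 2 * sqnorm (m - z).
    by rewrite sumr_const card_ord mulr_natl.
  by apply: ler_sum => i _; exact: gradient_lipschitz.
have lipe : sqnorm e <= L ^+ 2 * (n%:R^-1 * \sum_i sqnorm (x i - m)).
  apply: (le_trans (sqnorm_mean_le hn _)); rewrite mulrCA ler_wpM2l //.
  rewrite mulr_sumr; apply: ler_sum => i _.
  by rewrite -[sqnorm (x i - m)]sqnormN opprB; exact: gradient_lipschitz.
have -> : m - z - a *: (gm - e) = (m - z - a *: gm) + a *: e.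
  by rewrite scalerBr opprB addrA addrAC.
have young := young_dotp (m - z - a *: gm) e e0.
rewrite sqnormD dotpZr sqnormZ.
set V := n%:R^-1 * _ in lipe *.
have dD : sqnorm (m - z - a *: gm) <=
    (1 - 2 * a * mu + a ^+ 2 * L ^+ 2) * sqnorm (m - z).
  rewrite (sqnormB (m - z)) sqnormZ dotpZr (dotpC (m - z)).
  have := ler_wpM2l a0 mono; have := ler_wpM2l (sqr_ge0 a) lip; lra.
have s0 := sqnorm_ge0 (m - z).
have dD' : sqnorm (m - z - a *: gm) <= sqnorm (m - z).
  apply: (le_trans dD); have := ler_wpM2l (mulr_ge0 a0 s0) aL; lra.
have h1 := ler_wpM2l a0 young.
have h2 := ler_wpM2l (mulr_ge0 a0 (ltW e0)) dD'.
have ie0 : 0 <= eta^-1 by rewrite invr_ge0 ltW.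
have h3 := ler_wpM2l (mulr_ge0 a0 ie0) lipe.
have h4 := ler_wpM2l (sqr_ge0 a) lipe.
lra.
Qed.

End gradients.

(** * Expectation of real random variables *)

Section expectation.
Context d (T : measurableType d) (R : realType) (P : probability T R).
Implicit Types (X Y U Z : T -> R).

Definition summable X := P.-integrable setT (EFin \o X).
(** Real-valued expectation; it is the genuine one on [summable] variables. *)
Definition expect X : R := \int[P]_w X w.

Lemma summable_measurable X : summable X -> measurable_fun setT X.
Proof. by move=> /integrableP[/measurable_EFinP]. Qed.

Lemma summable_le X Y : measurable_fun setT X -> (forall w, `|X w| <= Y w) ->
  summable Y -> summable X.
Proof.
move=> mX XY iY; apply: le_integrable iY => //.
  exact/measurable_EFinP.
by move=> w _ /=; rewrite lee_fin (le_trans (XY w)) // ler_norm.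
Qed.

Lemma summable_cst c : summable (fun=> c).
Proof. exact: finite_measure_integrable_cst. Qed.

Lemma summableD X Y : summable X -> summable Y -> summable (fun w => X w + Y w).
Proof. by move=> iX iY; exact: (integrableD _ iX iY). Qed.

Lemma summableZ a X : summable X -> summable (fun w => a * X w).
Proof. by move=> iX; exact: (integrableZl _ _ iX). Qed.

Lemma summableB X Y : summable X -> summable Y -> summable (fun w => X w - Y w).
Proof. by move=> iX iY; exact: (integrableB _ iX iY). Qed.

Lemma summable_sum I (s : seq I) (F : I -> T -> R) :
  (forall i, summable (F i)) -> summable (fun w => \sum_(i <- s) F i w).
Proof.
move=> iF; elim: s => [|i s IH].
  by under eq_fun do rewrite big_nil; exact: summable_cst.
by under eq_fun do rewrite big_cons; exact: summableD.
Qed.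

Lemma summable_bounded X Y c : summable X -> measurable_fun setT Y ->
  (forall w, `|Y w| <= c) -> summable (fun w => X w * Y w).
Proof.
move=> iX mY Yc; apply: (@summable_le _ (fun w => c * `|X w|)).
- by apply: measurable_funM => //; exact: summable_measurable.
- by move=> w; rewrite normrM mulrC ler_wpM2r.
- exact/summableZ/(integrable_norm iX).
Qed.

Lemma expectD X Y : summable X -> summable Y ->
  expect (fun w => X w + Y w) = expect X + expect Y.
Proof. by move=> iX iY; exact: RintegralD. Qed.

Lemma expectB X Y : summable X -> summable Y ->
  expect (fun w => X w - Y w) = expect X - expect Y.
Proof. by move=> iX iY; exact: RintegralB. Qed.

Lemma expectZ a X : summable X -> expect (fun w => a * X w) = a * expect X.
Proof. by move=> iX; exact: RintegralZl. Qed.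

Lemma expect_cst c : expect (fun=> c) = c.
Proof.
rewrite /expect Rintegral_cst //; have /= -> := probability_setT P.
by rewrite mulr1.
Qed.

Lemma expect_sum I (s : seq I) (F : I -> T -> R) :
  (forall i, summable (F i)) ->
  expect (fun w => \sum_(i <- s) F i w) = \sum_(i <- s) expect (F i).
Proof.
move=> iF; elim: s => [|i s IH].
  rewrite big_nil; transitivity (expect (fun=> 0)); last exact: expect_cst.
  by congr expect; apply/funext => w; rewrite big_nil.
rewrite big_cons -IH -expectD //; last exact: summable_sum.
by congr expect; apply/funext => w; rewrite big_cons.
Qed.

Lemma expect_le X Y : summable X -> summable Y -> (forall w, X w <= Y w) ->
  expect X <= expect Y.
Proof. by move=> iX iY XY; apply: le_Rintegral. Qed.

Lemma expect_ge0 X : (forall w, 0 <= X w) -> 0 <= expect X.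
Proof. by move=> X0; exact: Rintegral_ge0. Qed.

(** [Y] coincides almost surely with the maximum of [X] and [Y]. *)
Lemma expect_le_ae X Y : summable X -> summable Y ->
  {ae P, forall w, X w <= Y w} -> expect X <= expect Y.
Proof.
move=> iX iY XY; pose Z w := Num.max (X w) (Y w).
have mX := summable_measurable iX; have mY := summable_measurable iY.
have mZ : measurable_fun setT Z by exact: measurable_maxr.
have iZ : summable Z.
  apply: (@summable_le _ (fun w => `|X w| + `|Y w|)) => //.
    move=> w; rewrite /Z; case: (leP (X w) (Y w)) => _.
      by rewrite lerDr.
    by rewrite lerDl.
  by apply: summableD; exact: integrable_norm.
have -> : expect Y = expect Z.
  rewrite /expect /Rintegral; congr fine.
  apply: ae_eq_integral => //; try exact/measurable_EFinP.
  apply: filterS XY => w XY _ /=.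
  by rewrite /Z; congr EFin; apply/esym/max_idPr.
by apply: expect_le => // w; rewrite /Z le_max lexx.
Qed.

Lemma expectation_expect X : summable X -> ('E_P[X] = (expect X)%:E)%E.
Proof.
by move=> iX; rewrite unlock /expect /Rintegral fineK //; exact: integrable_fin_num.
Qed.

Lemma integral_restrict_indic X D : measurable D ->
  (\int[P]_(w in D) (X w)%:E)%E = (\int[P]_w (X w * \1_D w)%:E)%E.
Proof.
move=> mD; rewrite integral_mkcond; apply: eq_integral => w _.
rewrite /restrict; case: ifPn => [wD|wD].
  by rewrite indicE wD mulr1.
by rewrite indicE (negbTE wD) mulr0.
Qed.

Lemma summable_indic X D : measurable D -> summable X ->
  summable (fun w => X w * \1_D w).
Proof.
move=> mD iX; apply: (@summable_bounded _ _ 1) => //.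
by move=> w; rewrite indicE; case: (_ \in _); rewrite ?normr1 ?normr0.
Qed.

(** Dominated convergence, in the form that extends the vanishing of an
    expectation from simple functions to their limits. *)
Lemma expect_dominated (F : nat -> T -> R) X Y :
  (forall n, measurable_fun setT (F n)) -> summable Y ->
  (forall n w, `|F n w| <= Y w) -> (forall w, F ^~ w @ \oo --> X w) ->
  (forall n, expect (F n) = 0) -> expect X = 0.
Proof.
move=> mF iY FY FX F0.
have iF n : summable (F n) by exact: summable_le (FY n) iY.
have cF w : (EFin \o F^~ w) x @[x --> \oo] --> (X w)%:E.
  by apply: cvg_EFin; [exact: nearW|exact: FX].
have h : (\int[P]_w (F n w)%:E)%E @[n --> \oo] --> (\int[P]_w (X w)%:E)%E.
  apply: (@dominated_cvg _ _ _ P setT measurableT (fun n => EFin \o F n)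
      (EFin \o X) (EFin \o Y)) => //=.
  - by move=> n; exact/measurable_EFinP.
  - by move=> w _; exact: cF.
  - by move=> n w _; rewrite lee_fin.
have e n : (\int[P]_w (F n w)%:E)%E = 0%E.
  have := F0 n; rewrite /expect /Rintegral => e.
  rewrite -[LHS]fineK ?e //.
  by apply: integrable_fin_num => //; exact: iF.
rewrite /expect /Rintegral.
suff -> : (\int[P]_w (X w)%:E)%E = 0%E by [].
move: h; rewrite (_ : (fun n => _) = cst 0%E); last exact/funext.
move=> h; by rewrite -(cvg_lim _ h) // lim_cst.
Qed.

End expectation.

(** * Orthogonality to a sub-sigma-algebra *)

Definition adapted d (T : measurableType d) (G : set (set T)) d'
    (T' : measurableType d') (f : T -> T') : Prop :=
  measurable_fun (T := g_sigma_algebraType G) setT f.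

Section simple_approximation.
Import HBSimple HBNNSimple.

(** Stated over an arbitrary measurable type so that it applies to the carrier
    equipped with a sub-sigma-algebra. *)
Lemma simple_approximation d (T : measurableType d) (R : realType) (Z : T -> R) :
  measurable_fun setT Z -> (forall w, 0 <= Z w) ->
  exists (m : nat -> nat) (c : nat -> nat -> R) (A : nat -> nat -> set T),
    let F n w := \sum_(i < m n) c n i * \1_(A n i) w in
    [/\ forall n i, measurable (A n i), forall n w, `|F n w| <= Z w
      & forall w, F ^~ w @ \oo --> Z w].
Proof.
move=> mZ Z0; have mEZ : measurable_fun setT (EFin \o Z) by exact/measurable_EFinP.
pose s := nnsfun_approx measurableT mEZ.
have sZ w : (s n w)%:E @[n --> \oo] --> (Z w)%:E.
  exact: (@cvg_nnsfun_approx _ _ _ _ measurableT _ mEZ (fun x _ => Z0 x) w I).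
pose r n := finmap.enum_fset (fset_set (s n @` setT)).
exists (fun n => size (r n)), (fun n i => (r n)`_i),
  (fun n i => s n @^-1` [set (r n)`_i]) => F.
have FE n w : F n w = s n w by rewrite (fimfunEord (s n) w).
split.
- by move=> n i; rewrite -[X in measurable X]setTI; exact: measurable_funP.
- move=> n w; rewrite FE ger0_norm //.
  have nd : nondecreasing_seq (s ^~ w).
    by move=> a b ab; have /lefP := nd_nnsfun_approx measurableT mEZ ab; exact.
  have cs : s ^~ w @ \oo --> Z w by exact: (fine_cvg (sZ w)).
  rewrite -(cvg_lim _ cs) //; apply: nondecreasing_cvgn_le => //.
  by apply/cvg_ex; exists (Z w).
- by move=> w; under eq_cvg do rewrite FE; exact: (fine_cvg (sZ w)).
Qed.

End simple_approximation.

Section orthogonality.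
Context d (T : measurableType d) (R : realType) (P : probability T R).
Implicit Types (X Y U Z : T -> R) (G : set (set T)).

(** For integrable [U] and a sigma-algebra [G], this says that the conditional
    expectation of [U] given [G] vanishes. *)
Definition orth G U : Prop :=
  forall D, G D -> expect P (fun w => U w * \1_D w) = 0.

Lemma adapted_measurable G d' (T' : measurableType d') (f : T -> T') :
  <<s G>> `<=` measurable -> adapted G f -> measurable_fun setT f.
Proof. by move=> hG mf _ B mB; apply: hG; exact: mf. Qed.

Lemma orth_adapted_ge0 G U Z : <<s G>> `<=` measurable ->
  summable P U -> orth <<s G>> U -> adapted G Z -> (forall w, 0 <= Z w) ->
  summable P (fun w => U w * Z w) -> expect P (fun w => U w * Z w) = 0.
Proof.
move=> hG iU oU aZ Z0 iUZ.
have [m [c [A [mA FZ cvF]]]] := simple_approximation aZ Z0.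
have mAT n i : measurable (A n i : set T) by apply: hG; exact: mA.
apply: (@expect_dominated _ _ _ P
  (fun n w => U w * \sum_(i < m n) c n i * \1_(A n i) w) _
  (fun w => `|U w * Z w|)).
- move=> n; apply: measurable_funM; first exact: summable_measurable iU.
  apply: measurable_sum => i; apply: measurable_funM => //.
- exact: integrable_norm.
- move=> n w; rewrite !normrM ler_wpM2l // (ger0_norm (Z0 w)).
  exact: FZ.
- by move=> w; apply: cvgMr => //; exact: cvF.
move=> n.
have iF (i : 'I_(m n)) : summable P (fun w => c n i * (U w * \1_(A n i) w)).
  by apply: summableZ; exact: summable_indic.
transitivity (expect P
    (fun w => \sum_(i < m n) c n i * (U w * \1_(A n i) w))).
  congr expect; apply/funext => w; rewrite mulr_sumr.
  by apply: eq_bigr => i _; rewrite mulrCA.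
rewrite expect_sum //.
apply: big1 => i _; rewrite expectZ ?oU ?mulr0 //; last exact: summable_indic.
exact: mA.
Qed.

(** Positive and negative parts of [Z] are limits of combinations of indicators
    of events of [<<s G>>], dominated by [Z] itself. *)
Lemma orth_adapted G U Z : <<s G>> `<=` measurable ->
  summable P U -> orth <<s G>> U -> adapted G Z ->
  summable P (fun w => U w * Z w) -> expect P (fun w => U w * Z w) = 0.
Proof.
move=> hG iU oU aZ iUZ.
have mZ : measurable_fun setT Z by exact: adapted_measurable aZ.
have mU := summable_measurable iU.
pose Zp w := Num.max (Z w) 0; pose Zn w := Num.max (- Z w) 0.
have Zp0 w : 0 <= Zp w by rewrite /Zp le_max lexx orbT.
have Zn0 w : 0 <= Zn w by rewrite /Zn le_max lexx orbT.
have aZp : adapted G Zp by apply: measurable_maxr.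
have aZn : adapted G Zn by apply: measurable_maxr => //; exact: measurableT_comp.
have ZE w : U w * Z w = U w * Zp w - U w * Zn w.
  rewrite -mulrBr; congr (_ * _); rewrite /Zp /Zn.
  by case: (leP (Z w)); case: (leP (- Z w)); lra.
have dom (Y : T -> R) : adapted G Y -> (forall w, `|Y w| <= `|Z w|) ->
    summable P (fun w => U w * Y w).
  move=> aY YZ; apply: (@summable_le _ _ _ _ _ (fun w => `|U w * Z w|)).
  - by apply: measurable_funM => //; exact: adapted_measurable aY.
  - by move=> w; rewrite !normrM ler_wpM2l.
  - exact: integrable_norm.
have iZp : summable P (fun w => U w * Zp w).
  apply: dom => // w; rewrite ger0_norm // /Zp ge_max normr_ge0 andbT.
  exact: ler_norm.
have iZn : summable P (fun w => U w * Zn w).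
  apply: dom => // w; rewrite ger0_norm // /Zn ge_max normr_ge0 andbT.
  by rewrite -normrN ler_norm.
under eq_fun do rewrite ZE.
rewrite -[LHS]/(expect P (fun w => U w * Zp w - U w * Zn w)).
rewrite (expectB iZp iZn) (@orth_adapted_ge0 G) // (@orth_adapted_ge0 G) //.
by rewrite subrr.
Qed.

(** Stability under countable disjoint unions is the sigma-additivity of the
    integral. *)
Lemma orth_dynkin U : summable P U -> expect P U = 0 ->
  dynkin [set D | measurable D /\ expect P (fun w => U w * \1_D w) = 0].
Proof.
move=> iU U0; split.
- split=> //; rewrite -[RHS]U0; congr expect; apply/funext => w.
  by rewrite indicE in_setT mulr1.
- move=> D [mD D0]; split; first exact: measurableC.
  have -> : (fun w => U w * \1_(~` D) w) = (fun w => U w - U w * \1_D w).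
    apply/funext => w; rewrite !indicE in_setC.
    by case: (w \in D); rewrite /= ?mulr0 ?mulr1 ?subrr ?subr0.
  by rewrite expectB // ?U0 ?D0 ?subrr //; exact: summable_indic.
- move=> F tF mF; have mFk k : measurable (F k) by case: (mF k).
  have mU : measurable (\bigcup_k F k) by exact: bigcup_measurable.
  split=> //; rewrite /expect /Rintegral -integral_restrict_indic //.
  rewrite integral_bigcup //; last first.
    by apply: integrableS iU.
  rewrite eseries0 // => k _ _; rewrite integral_restrict_indic //.
  rewrite -[LHS]fineK; last first.
    by apply: integrable_fin_num => //; exact: summable_indic.
  by congr EFin; case: (mF k).
Qed.

(** The pi-lambda theorem: it suffices to test the vanishing of the integrals on
    a generating family that is stable under intersection. *)
Lemma orth_pi_system G U : setI_closed G -> G `<=` measurable ->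
  summable P U -> expect P U = 0 -> orth G U -> orth <<s G>> U.
Proof.
move=> piG mG iU U0 oU D sD.
suff [] : measurable D /\ expect P (fun w => U w * \1_D w) = 0 by [].
have /dynkin_lambda_system lam := orth_dynkin iU U0.
apply: (lambda_system_subset piG lam _ _ sD) => //.
by move=> A GA; split; [exact: mG|exact: oU].
Qed.

End orthogonality.

(** * Conditional expectation and conditional independence *)

Section conditional_expectation.
Context d (T : measurableType d) (R : realType) (P : probability T R).
Variable G : set (set T).
Hypothesis hG : <<s G>> `<=` measurable.
Implicit Types (X Y U Z q : T -> R) (B D : set T).

Lemma condexpP X Y : is_condexp P X <<s G>> Y ->
  [/\ summable P X, summable P Y, adapted G Y
    & orth P <<s G>> (fun w => X w - Y w)].
Proof.
case=> iX iY sY XY; split=> //.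
- by move=> _ B mB; rewrite setTI; apply: sY; exists B; rewrite ?setTI.
move=> D sD; have mD := hG sD.
have -> : (fun w => (X w - Y w) * \1_D w) =
    (fun w => X w * \1_D w - Y w * \1_D w).
  by apply/funext => w; rewrite mulrBl.
rewrite expectB; try exact: summable_indic.
by rewrite /expect /Rintegral -!integral_restrict_indic // XY // subrr.
Qed.

Lemma expect_ae_eq X Y : summable P X -> measurable_fun setT Y ->
  {ae P, forall w, X w = Y w} -> expect P X = expect P Y.
Proof.
move=> iX mY XY; congr fine; apply: ae_eq_integral => //.
- exact/measurable_EFinP/(summable_measurable iX).
- exact/measurable_EFinP.
- by apply: filterS XY => w -> _.
Qed.

Lemma expect_ge0_eq0 X : summable P X -> (forall w, 0 <= X w) ->
  expect P X = 0 -> {ae P, forall w, X w = 0}.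
Proof.
move=> iX X0 EX.
have e : (\int[P]_w `|(X w)%:E| = 0)%E.
  under eq_integral do rewrite gee0_abs ?lee_fin //.
  have f : (\int[P]_w (X w)%:E)%E \is a fin_num by exact: integrable_fin_num.
  by rewrite -(fineK f); congr EFin.
have mX : measurable_fun setT (EFin \o X).
  exact/measurable_EFinP/(summable_measurable iX).
have := ae_eq_integral_abs P measurableT mX.
move=> /iffLR /(_ e); apply: filterS => w /(_ I) /= -[].
by [].
Qed.

Lemma orth_sign_ae U D : summable P U -> orth P <<s G>> U -> <<s G>> D ->
  (forall w, D w -> 0 <= U w) -> {ae P, forall w, D w -> U w = 0}.
Proof.
move=> iU oU sD U0; have mD := hG sD.
have i1 : summable P (fun w => U w * \1_D w) by exact: summable_indic.
have h := expect_ge0_eq0 i1 _ (oU D sD).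
have {}h : {ae P, forall w, U w * \1_D w = 0}.
  apply: h => w; rewrite indicE; case: (asboolP (D w)) => Dw.
    by rewrite mem_set // mulr1 U0.
  by rewrite memNset // mulr0.
by apply: filterS h => w + Dw; rewrite indicE mem_set // mulr1.
Qed.

Lemma adapted_lt X Y : adapted G X -> adapted G Y -> <<s G>> [set w | X w < Y w].
Proof.
move=> aX aY.
have := measurable_fun_ltr aX aY.
move=> /(_ measurableT [set true] I); by rewrite setTI; congr (<<s G>> _).
Qed.

(** [U] may be tested against the events where it is positive, respectively
    negative. *)
Lemma orth_adapted_ae0 U : summable P U -> orth P <<s G>> U -> adapted G U ->
  {ae P, forall w, U w = 0}.
Proof.
move=> iU oU aU.
have a0 : adapted G (fun=> 0 : R) by exact: measurable_cst.
have h1 := orth_sign_ae iU oU (adapted_lt a0 aU) (fun w h => ltW h).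
have iN : summable P (fun w => - U w).
  by under eq_fun do rewrite -mulN1r; exact: summableZ.
have oN : orth P <<s G>> (fun w => - U w).
  move=> D sD; have -> : (fun w => - U w * \1_D w) = (fun w => -1 * (U w * \1_D w)).
    by apply/funext => w; rewrite mulN1r mulNr.
  rewrite expectZ ?oU ?mulr0 //; exact: summable_indic (hG sD) iU.
have Uneg w : U w < 0 -> 0 <= - U w by rewrite oppr_ge0 => /ltW.
have h2 := orth_sign_ae iN oN (adapted_lt aU a0) Uneg.
apply: filterS2 h1 h2 => w /= h1 h2.
have [||//] := ltrgtP (U w) 0; last by move/h1.
by move/h2/eqP; rewrite oppr_eq0 => /eqP.
Qed.

Lemma condexp_unique X Y Y' : is_condexp P X <<s G>> Y ->
  is_condexp P X <<s G>> Y' -> {ae P, forall w, Y w = Y' w}.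
Proof.
move=> /condexpP[iX iY aY oY] /condexpP[_ iY' aY' oY'].
have h : {ae P, forall w, Y w - Y' w = 0}.
  apply: orth_adapted_ae0; [exact: summableB| |exact: measurable_funB].
  move=> D sD; have mD := hG sD.
  have -> : (fun w => (Y w - Y' w) * \1_D w) =
      (fun w => (X w - Y' w) * \1_D w - (X w - Y w) * \1_D w).
    by apply/funext => w; ring.
  by rewrite expectB ?oY ?oY' ?subrr //; apply: summable_indic => //;
    exact: summableB.
by apply: filterS h => w /eqP; rewrite subr_eq0 => /eqP.
Qed.

(** On the event [q < 0] the difference [\1_B - q] is positive and has mean
    zero, so this event is null; likewise for [1 < q].  Truncating [q] to
    [0, 1] therefore changes it on a null set only. *)
Lemma condexp_indic_bounded B q : is_condexp P \1_B <<s G>> q ->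
  exists q', [/\ adapted G q', forall w, 0 <= q' w <= 1
    & {ae P, forall w, q w = q' w}].
Proof.
move=> /condexpP[iB iq aq oq].
have a0 : adapted G (fun=> 0 : R) by exact: measurable_cst.
have a1 : adapted G (fun=> 1 : R) by exact: measurable_cst.
have ind w : 0 <= \1_B w :> R /\ \1_B w <= 1 :> R.
  by rewrite indicE; case: (_ \in _).
exists (fun w => Num.max 0 (Num.min (q w) 1)); split.
- by apply: measurable_maxr => //; exact: measurable_minr.
- by move=> w; rewrite le_max lexx /= ge_max ler01 ge_min lexx orbT.
have iU : summable P (fun w => \1_B w - q w) by exact: summableB.
have iV : summable P (fun w => q w - \1_B w) by exact: summableB.
have oV : orth P <<s G>> (fun w => q w - \1_B w).
  move=> D sD; have mD := hG sD.
  have -> : (fun w => (q w - \1_B w) * \1_D w) =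
      (fun w => -1 * ((\1_B w - q w) * \1_D w)).
    by apply/funext => w; ring.
  by rewrite expectZ ?oq ?mulr0 //; exact: summable_indic.
have lo w : q w < 0 -> 0 <= \1_B w - q w by have [] := ind w; lra.
have hi w : 1 < q w -> 0 <= q w - \1_B w by have [] := ind w; lra.
have h1 := orth_sign_ae iU oq (adapted_lt aq a0) lo.
have h2 := orth_sign_ae iV oV (adapted_lt a1 aq) hi.
apply: filterS2 h1 h2 => w /= h1 h2; have [i0 i1] := ind w.
have q0 : 0 <= q w by case: (leP 0 (q w)) => // n; have := h1 n; lra.
have q1 : q w <= 1 by case: (leP (q w) 1) => // n; have := h2 n; lra.
by rewrite (min_idPl q1) (max_idPr q0).
Qed.

End conditional_expectation.

Section conditional_independence.
Context d (T : measurableType d) (R : realType) (P : probability T R).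
Context (n m : nat) (X : 'I_n -> T -> 'rV[R]_m) (G : set (set T)).
Hypothesis hG : <<s G>> `<=` measurable.
Hypothesis mX : forall i, measurable_fun setT (X i).
Hypothesis indX : cond_independent P X <<s G>>.

Let event (i : 'I_n) (B : set 'rV[R]_m) : set T := X i @^-1` B.

Lemma measurable_event i B : measurable B -> measurable (event i B).
Proof. by move=> mB; rewrite /event -[X in measurable X]setTI; exact: mX. Qed.

Lemma indic_unit (A : set T) w : 0 <= (\1_A w : R) <= 1.
Proof. by rewrite indicE; case: (_ \in _); rewrite /= ?lexx ?ler01. Qed.

Lemma summable_unit_mul (U Z : T -> R) : summable P U ->
  measurable_fun setT Z -> (forall w, 0 <= Z w <= 1) ->
  summable P (fun w => U w * Z w).
Proof.
move=> iU mZ Z01; apply: (@summable_bounded _ _ _ _ _ _ 1) => // w.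
by have /andP[z0 z1] := Z01 w; rewrite ger0_norm.
Qed.

(** [q] is a bounded version of the conditional probability of [X j \in B'].  It
    may replace the indicator of that event on every event that only involves the
    past and [X i]: the conditional probability of the joint event is the product
    of [q] with that of [X i \in B], and the latter integrates against the
    [G]-measurable [q * \1_D] like the indicator itself. *)
Lemma cond_independent_pair i j (B' : set 'rV[R]_m) : i != j -> measurable B' ->
  exists q : T -> R, [/\ adapted G q, forall w, 0 <= q w <= 1
    & forall B D, measurable B -> <<s G>> D ->
      expect P (fun w => (\1_(event j B') w - q w) * \1_(D `&` event i B) w)
      = 0].
Proof.
move=> ij mB'.
pose Bf B l : set 'rV[R]_m := if l == i then B else if l == j then B' else setT.
have mBf B l : measurable B -> measurable (Bf B l).
  by move=> mB; rewrite /Bf; case: ifP => // _; case: ifP.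
have [qs0 [cqs0 _]] := indX (fun l => mBf setT l measurableT).
have := cqs0 j; rewrite /Bf eq_sym (negbTE ij) eqxx => cj0.
have [q [aq q01 qae]] := condexp_indic_bounded hG cj0.
exists q; split=> // B D mB sD.
have mD := hG sD.
have [qs [cqs cprod]] := indX (fun l => mBf B l mB).
have cqi := cqs i; rewrite /Bf eqxx in cqi.
have cqj := cqs j; rewrite /Bf eq_sym (negbTE ij) eqxx in cqj.
have mq : measurable_fun setT q by exact: adapted_measurable aq.
have qj_ae : {ae P, forall w, qs j w = q w}.
  by apply: filterS2 (condexp_unique hG cqj cj0) qae => w -> ->.
have q1_ae : {ae P, forall w, forall l, l != i -> l != j -> qs l w = 1}.
  apply: filter_forall => l.
  case: (eqVneq l i) => [_|li]; first exact: nearW.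
  case: (eqVneq l j) => [_|lj]; first exact: nearW.
  have := cqs l; rewrite /Bf (negbTE li) (negbTE lj) preimage_setT => cl.
  have c1 : is_condexp P \1_[set: T] <<s G>> (fun=> 1 : R).
    have -> : (fun=> 1) = \1_[set: T] :> (T -> R).
      by apply/funext => w; rewrite indicE in_setT.
    split=> //.
    - by apply/integrable_indic.
    - by apply/integrable_indic.
    - move=> _ [C mC <-]; rewrite setTI.
      have : adapted G (\1_[set: T] : T -> R) by exact: measurable_indic.
      by move=> /(_ measurableT C mC); rewrite setTI.
  by apply: filterS (condexp_unique hG cl c1) => w h _ _.
have prod_ae : {ae P, forall w, \prod_(l < n) qs l w = qs i w * q w}.
  apply: filterS2 qj_ae q1_ae => w <- h.
  rewrite (bigD1 i) //= (bigD1 j) 1?eq_sym //= big1 ?mulr1 // => l /andP[li lj].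
  exact: h.
have [iS iprod aprod oprod] := condexpP hG cprod.
have [iSi iqi aqi oqi] := condexpP hG cqi.
have mev := measurable_event.
have capE : \bigcap_(l in [set: 'I_n]) X l @^-1` Bf B l =
    event i B `&` event j B'.
  apply/seteqP; split=> [w h|w [hi hj] l _].
    by split; [have := h i I|have := h j I]; rewrite /Bf eqxx // eq_sym
      (negbTE ij).
  rewrite /Bf; case: eqP => [->|_]; first exact: hi.
  by case: eqP => [->|_].
have E1 : expect P (fun w => \1_(event i B `&` event j B') w * \1_D w) =
    expect P (fun w => qs i w * q w * \1_D w).
  have := oprod D sD; rewrite capE in iS *.
  have -> : (fun w => (\1_(event i B `&` event j B') w - \prod_(l < n) qs l w)
      * \1_D w) = (fun w => \1_(event i B `&` event j B') w * \1_D w -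
      \prod_(l < n) qs l w * \1_D w).
    by apply/funext => w; rewrite mulrBl.
  rewrite expectB; try exact: summable_indic.
  move=> /eqP; rewrite subr_eq0 => /eqP ->.
  apply: expect_ae_eq; first exact: summable_indic.
    apply: measurable_funM => //; apply: measurable_funM => //.
    exact: summable_measurable iqi.
  by apply: filterS prod_ae => w ->.
have Z01 w : 0 <= q w * \1_D w <= 1.
  have /andP[a b] := q01 w; have /andP[c e] := indic_unit D w.
  by rewrite mulr_ge0 //= mulr_ile1.
have aZ : adapted G (fun w => q w * \1_D w).
  by apply: measurable_funM => //; exact: measurable_indic.
have mZ : measurable_fun setT (fun w => q w * \1_D w).
  exact: adapted_measurable aZ.
have E2 : expect P (fun w => (\1_(event i B) w - qs i w) * (q w * \1_D w)) = 0.
  apply: (orth_adapted hG) => //; first exact: summableB.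
  by apply: summable_unit_mul => //; exact: summableB.
have -> : (fun w => (\1_(event j B') w - q w) * \1_(D `&` event i B) w) =
   (fun w => \1_(event i B `&` event j B') w * \1_D w -
      ((\1_(event i B) w - qs i w) * (q w * \1_D w) + qs i w * q w * \1_D w)).
  by apply/funext => w; rewrite !indicI /=; ring.
have i1 : summable P (fun w => \1_(event i B `&` event j B') w * \1_D w).
  by apply: summable_indic => //; rewrite -capE.
have i2 : summable P (fun w => (\1_(event i B) w - qs i w) * (q w * \1_D w)).
  by apply: summable_unit_mul => //; exact: summableB.
have i3 : summable P (fun w => qs i w * q w * \1_D w).
  by under eq_fun do rewrite -mulrA; exact: summable_unit_mul.
by rewrite expectB //; [rewrite expectD // E1 E2 add0r subrr|exact: summableD].
Qed.

(** The rectangles form a pi-system that generates the sigma-algebra of the past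
    together with [X i]. *)
Definition joint i : set (set T) :=
  [set A | exists D B, [/\ <<s G>> D, measurable B & A = D `&` event i B]].

Lemma joint_setI i : setI_closed (joint i).
Proof.
move=> _ _ [D [B [sD mB ->]]] [D' [B' [sD' mB' ->]]].
exists (D `&` D'), (B `&` B'); split.
- by apply: (@measurableI _ (g_sigma_algebraType G)).
- exact: measurableI.
- by rewrite /event preimage_setI setIACA.
Qed.

Lemma joint_measurable i : joint i `<=` measurable.
Proof.
move=> _ [D [B [sD mB ->]]]; apply: measurableI; first exact: hG.
exact: measurable_event.
Qed.

Lemma sigma_joint_measurable i : <<s joint i>> `<=` measurable.
Proof.
apply: smallest_sub; last exact: joint_measurable.
exact: sigma_algebra_measurable.
Qed.

Lemma sub_joint i : <<s G>> `<=` <<s joint i>>.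
Proof.
move=> D sD; apply: sub_sigma_algebra; exists D, setT; split=> //.
by rewrite /event preimage_setT setIT.
Qed.

Lemma adapted_joint i d' (T' : measurableType d') (f : T -> T') :
  adapted G f -> adapted (joint i) f.
Proof. by move=> af _ B mB; apply: sub_joint; exact: af. Qed.

Lemma adapted_joint_self i : adapted (joint i) (X i).
Proof.
move=> _ B mB; apply: sub_sigma_algebra; exists setT, B; split=> //.
exact: (@measurableT _ (g_sigma_algebraType G)).
Qed.

(** It is enough to integrate [U] over a rectangle [D `&` X j @^-1` B'].  There
    the indicator of [X j @^-1` B'] may be replaced by [q], because [U * \1_D]
    only depends on the past and on [X i]; and [U] is orthogonal to the past,
    hence to [q * \1_D]. *)
Lemma cond_independent_orth i j (U V : T -> R) : i != j ->
  adapted (joint i) U -> adapted (joint j) V ->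
  summable P U -> orth P <<s G>> U -> summable P (fun w => U w * V w) ->
  expect P (fun w => U w * V w) = 0.
Proof.
move=> ij aU aV iU oU iUV.
have U0 : expect P U = 0.
  rewrite -(oU setT); last exact: (@measurableT _ (g_sigma_algebraType G)).
  by congr expect; apply/funext => w; rewrite indicE in_setT mulr1.
apply: (orth_adapted (@sigma_joint_measurable j)) => //.
apply: orth_pi_system => //; [exact: joint_setI|exact: joint_measurable|].
move=> _ [D [B' [sD mB' ->]]].
have mD := hG sD; have mB := measurable_event j mB'.
have [q [aq q01 hq]] := cond_independent_pair ij mB'.
have mq : measurable_fun setT q by exact: adapted_measurable aq.
have iqV : summable P (fun w => \1_(event j B') w - q w).
  apply: summableB; first exact: integrable_indic.
  have -> : q = (fun w => 1 * q w) by apply/funext => w; rewrite mul1r.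
  by apply: summable_unit_mul => //; exact: summable_cst.
have ojV : orth P <<s joint i>> (fun w => \1_(event j B') w - q w).
  apply: orth_pi_system => //; [exact: joint_setI|exact: joint_measurable| |].
    have := hq setT setT measurableT (@measurableT _ (g_sigma_algebraType G)).
    rewrite /event preimage_setT setTI => <-.
    by congr expect; apply/funext => w; rewrite (indicE _ setT) in_setT mulr1.
  by move=> _ [D' [B [sD' mB0 ->]]]; exact: hq.
have iUD : summable P (fun w => U w * \1_D w) by exact: summable_indic.
have aD : adapted G (\1_D : T -> R) by exact: measurable_indic.
have s1 : summable P
    (fun w => (\1_(event j B') w - q w) * (U w * \1_D w)).
  under eq_fun do rewrite mulrC.
  apply: (@summable_bounded _ _ _ _ _ _ 1) => //.
    by apply: measurable_funB => //; exact: measurable_indic.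
  move=> w; have /andP[a b] := q01 w; have /andP[c e] := indic_unit (event j B') w.
  by rewrite ler_norml; apply/andP; split; lra.
have h1 : expect P
    (fun w => (\1_(event j B') w - q w) * (U w * \1_D w)) = 0.
  apply: (orth_adapted (@sigma_joint_measurable i)) => //.
  by apply: measurable_funM => //; exact: adapted_joint aD.
have aqD : adapted G (fun w => q w * \1_D w) by exact: measurable_funM.
have Z01 w : 0 <= q w * \1_D w <= 1.
  have /andP[a b] := q01 w; have /andP[c e] := indic_unit D w.
  by rewrite mulr_ge0 //= mulr_ile1.
have s2 : summable P (fun w => U w * (q w * \1_D w)).
  by apply: summable_unit_mul => //; exact: adapted_measurable aqD.
have h2 : expect P (fun w => U w * (q w * \1_D w)) = 0.
  exact: (orth_adapted hG).
have -> : (fun w => U w * \1_(D `&` event j B') w) =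
    (fun w => (\1_(event j B') w - q w) * (U w * \1_D w)
              + U w * (q w * \1_D w)).
  by apply/funext => w; rewrite indicI /=; ring.
by rewrite expectD // h1 h2 addr0.
Qed.

End conditional_independence.

(** * Square-integrable vectors and gradient noise *)

Section measurable_vectors.
Context {R : realType} {p : nat}.

Lemma measurable_coord (j : 'I_p) :
  measurable_fun setT (fun v : 'rV[R]_p => v 0 j).
Proof.
move=> _ B mB; rewrite setTI; apply: sub_sigma_algebra => /=.
rewrite -bigcup_seq /=; exists j; first by rewrite /= mem_index_enum.
by exists B => //; rewrite setTI.
Qed.

Lemma measurable_rV d (T : measurableType d) (u : T -> 'rV[R]_p) :
  (forall j, measurable_fun setT (fun w => u w 0 j)) -> measurable_fun setT u.
Proof.
move=> mu _ B; rewrite setTI => sB.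
suff : image_set_system setT u measurable B by rewrite /image_set_system /= setTI.
apply: sB; split.
  by apply: sigma_algebra_image; exact: sigma_algebra_measurable.
rewrite -bigcup_seq => _ [j _ [C mC <-]].
rewrite /image_set_system /= !setTI -comp_preimage.
by have := mu j measurableT C mC; rewrite setTI.
Qed.

End measurable_vectors.

Section square_integrable.
Context d (T : measurableType d) (R : realType) (P : probability T R).
Implicit Types X Y : T -> R.

Definition sq_integrable X : Prop :=
  measurable_fun setT X /\ summable P (fun w => X w ^+ 2).

Lemma sq_integrable_le X Y : measurable_fun setT X ->
  (forall w, X w ^+ 2 <= Y w) -> summable P Y -> sq_integrable X.
Proof.
move=> mX XY iY; split=> //; apply: summable_le iY; first exact: measurable_funX.
by move=> w; rewrite ger0_norm ?sqr_ge0.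
Qed.

Lemma summableM X Y : sq_integrable X -> sq_integrable Y ->
  summable P (fun w => X w * Y w).
Proof.
move=> [mX iX] [mY iY].
apply: (@summable_le _ _ _ _ _ (fun w => X w ^+ 2 + Y w ^+ 2)).
- exact: measurable_funM.
- move=> w; have h1 := sqr_ge0 (X w - Y w); have h2 := sqr_ge0 (X w + Y w).
  have h3 := sqr_ge0 (X w); have h4 := sqr_ge0 (Y w).
  by rewrite ler_norml; apply/andP; split; lra.
- exact: summableD.
Qed.

Lemma sq_integrableD X Y : sq_integrable X -> sq_integrable Y ->
  sq_integrable (fun w => X w + Y w).
Proof.
move=> [mX iX] [mY iY].
apply: (@sq_integrable_le _ (fun w => 2 * (X w ^+ 2 + Y w ^+ 2))).
- exact: measurable_funD.
- by move=> w; have := sqr_ge0 (X w - Y w); lra.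
- by apply: summableZ; exact: summableD.
Qed.

Lemma sq_integrableZ a X : sq_integrable X -> sq_integrable (fun w => a * X w).
Proof.
move=> [mX iX]; split; first by apply: measurable_funM.
by under eq_fun do rewrite exprMn; exact: summableZ.
Qed.

Lemma sq_integrable_cst c : sq_integrable (fun=> c).
Proof. by split; [exact: measurable_cst|exact: summable_cst]. Qed.

Lemma sq_integrable_sum I (s : seq I) (F : I -> T -> R) :
  (forall i, sq_integrable (F i)) -> sq_integrable (fun w => \sum_(i <- s) F i w).
Proof.
move=> hF; elim: s => [|i s IH].
  by under eq_fun do rewrite big_nil; exact: sq_integrable_cst.
by under eq_fun do rewrite big_cons; exact: sq_integrableD.
Qed.

Section vectors.
Context {p : nat}.
Implicit Types (u v : T -> 'rV[R]_p).

Definition sq_integrable_rV u : Prop := forall c, sq_integrable (fun w => u w 0 c).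

Lemma rV_sq_integrableD u v : sq_integrable_rV u -> sq_integrable_rV v ->
  sq_integrable_rV (fun w => u w + v w).
Proof.
by move=> hu hv c; under eq_fun do rewrite mxE; exact: sq_integrableD.
Qed.

Lemma rV_sq_integrableZ a u : sq_integrable_rV u ->
  sq_integrable_rV (fun w => a *: u w).
Proof.
by move=> hu c; under eq_fun do rewrite mxE; exact: sq_integrableZ.
Qed.

Lemma rV_sq_integrableB u v : sq_integrable_rV u -> sq_integrable_rV v ->
  sq_integrable_rV (fun w => u w - v w).
Proof.
move=> hu hv; under eq_fun do rewrite -scaleN1r.
by apply: rV_sq_integrableD => //; exact: rV_sq_integrableZ.
Qed.

Lemma rV_sq_integrable_cst z : sq_integrable_rV (fun=> z).
Proof. by move=> c; exact: sq_integrable_cst. Qed.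

Lemma rV_sq_integrable_sum I (s : seq I) (F : I -> T -> 'rV[R]_p) :
  (forall i, sq_integrable_rV (F i)) ->
  sq_integrable_rV (fun w => \sum_(i <- s) F i w).
Proof.
move=> hF c; under eq_fun do rewrite summxE.
exact: (@sq_integrable_sum _ _ (fun i w => F i w 0 c) (fun i => hF i c)).
Qed.

Lemma summable_dotp u v : sq_integrable_rV u -> sq_integrable_rV v ->
  summable P (fun w => dotp (u w) (v w)).
Proof.
by move=> hu hv; apply: summable_sum => c; exact: summableM.
Qed.

Lemma summable_sqnorm u : sq_integrable_rV u -> summable P (fun w => sqnorm (u w)).
Proof. by move=> hu; exact: summable_dotp. Qed.

Lemma sqr_coord_le (z : 'rV[R]_p) c : z 0 c ^+ 2 <= sqnorm z.
Proof.
rewrite /sqnorm /dotp (bigD1 c) //= lerDl sumr_ge0 // => j _.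
exact: sqr_ge0.
Qed.

Lemma sqnorm_sq_integrable u (Y : T -> R) :
  (forall c, measurable_fun setT (fun w => u w 0 c)) ->
  (forall w, sqnorm (u w) <= Y w) -> summable P Y -> sq_integrable_rV u.
Proof.
move=> mu uY iY c; apply: sq_integrable_le iY => // w.
exact: le_trans (sqr_coord_le _ _) (uY w).
Qed.

Lemma expect_dotp u v : sq_integrable_rV u -> sq_integrable_rV v ->
  expect P (fun w => dotp (u w) (v w)) =
  \sum_c expect P (fun w => u w 0 c * v w 0 c).
Proof. by move=> hu hv; apply: expect_sum => c; exact: summableM. Qed.

Lemma expect_sqnormB a u v : sq_integrable_rV u -> sq_integrable_rV v ->
  expect P (fun w => dotp (u w) (v w)) = 0 ->
  expect P (fun w => sqnorm (u w - a *: v w)) =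
  expect P (fun w => sqnorm (u w)) + a ^+ 2 * expect P (fun w => sqnorm (v w)).
Proof.
move=> hu hv uv0.
have iu := summable_sqnorm hu; have iv := summable_sqnorm hv.
have iuv := summable_dotp hu hv.
transitivity (expect P (fun w => sqnorm (u w) +
    (a ^+ 2 * sqnorm (v w) + - (2 * a) * dotp (u w) (v w)))).
  by congr expect; apply/funext => w; rewrite sqnormB sqnormZ dotpZr; ring.
rewrite expectD // ?expectD ?expectZ // ?uv0 ?mulr0 ?addr0 //;
  by do ?[apply: summableD|apply: summableZ].
Qed.

End vectors.
End square_integrable.

Section noise.
Context d (T : measurableType d) (R : realType) (P : probability T R).
Context (n p : nat) (G : set (set T)) (e : 'I_n -> T -> 'rV[R]_p).
Hypothesis hn : (0 < n)%N.
Hypothesis hG : <<s G>> `<=` measurable.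
Hypothesis L2e : forall i, sq_integrable_rV P (e i).
Hypothesis orth_e : forall i c, orth P <<s G>> (fun w => e i w 0 c).
Hypothesis uncorr : forall i j c, i != j ->
  expect P (fun w => e i w 0 c * e j w 0 c) = 0.

Lemma sq_integrable_summable (X : T -> R) : sq_integrable P X -> summable P X.
Proof.
move=> hX; have -> : X = (fun w => 1 * X w) by apply/funext => w; rewrite mul1r.
by apply: summableM => //; exact: sq_integrable_cst.
Qed.

Lemma noise_orth i (u : T -> 'rV[R]_p) : sq_integrable_rV P u ->
  (forall c, adapted G (fun w => u w 0 c)) ->
  expect P (fun w => dotp (u w) (e i w)) = 0.
Proof.
move=> hu au; rewrite expect_dotp //; apply: big1 => c _.
under eq_fun do rewrite mulrC.
apply: (orth_adapted hG) => //; first exact/sq_integrable_summable/L2e.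
exact: summableM (L2e _ _) (hu _).
Qed.

Lemma mean_noise_L2 : sq_integrable_rV P (fun w => mean (fun i => e i w)).
Proof. by apply: rV_sq_integrableZ; exact: rV_sq_integrable_sum. Qed.

Lemma mean_noise_orth (u : T -> 'rV[R]_p) : sq_integrable_rV P u ->
  (forall c, adapted G (fun w => u w 0 c)) ->
  expect P (fun w => dotp (u w) (mean (fun i => e i w))) = 0.
Proof.
move=> hu au.
transitivity (expect P
    (fun w => n%:R^-1 * \sum_i dotp (u w) (e i w))).
  congr expect; apply/funext => w.
  by rewrite /mean dotpZr dotpC dotp_suml; congr (_ * _);
    apply: eq_bigr => i _; rewrite dotpC.
have ii i : summable P (fun w => dotp (u w) (e i w)) by exact: summable_dotp.
rewrite expectZ; last exact: summable_sum.
by rewrite expect_sum // big1 ?mulr0 // => i _; exact: noise_orth.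
Qed.

(** The cross terms vanish, so averaging divides the variance by the number of
    agents. *)
Lemma mean_noise_variance :
  expect P (fun w => sqnorm (mean (fun i => e i w))) =
  n%:R ^- 2 * \sum_i expect P (fun w => sqnorm (e i w)).
Proof.
have ii i j : summable P (fun w => dotp (e i w) (e j w)) by exact: summable_dotp.
transitivity (expect P
    (fun w => n%:R ^- 2 * \sum_i \sum_j dotp (e i w) (e j w))).
  congr expect; apply/funext => w.
  rewrite /mean sqnormZ exprVn; congr (_ * _).
  rewrite /sqnorm dotp_suml; apply: eq_bigr => i _.
  by rewrite dotpC dotp_suml; apply: eq_bigr => j _; rewrite dotpC.
rewrite expectZ; last by do 2 apply: summable_sum => ?; exact: ii.
congr (_ * _); rewrite expect_sum => [|i]; last exact: summable_sum.
apply: eq_bigr => i _; rewrite expect_sum // (bigD1 i) //= big1 ?addr0 // => j ji.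
rewrite expect_dotp //; apply: big1 => c _; rewrite uncorr // eq_sym.
exact: ji.
Qed.

End noise.

(** * One step of the algorithm *)

Section errors.
Context d (T : measurableType d) (R : realType) (P : probability T R).
Context (n p : nat) (y : 'I_n -> T -> 'rV[R]_p) (z : 'rV[R]_p).

Definition dist_err : R := \sum_i expect P (fun w => sqnorm (y i w - z)).
Definition opt_err : R := expect P (fun w => sqnorm (mean (y ^~ w) - z)).
Definition cons_err : R :=
  \sum_i expect P (fun w => sqnorm (y i w - mean (y ^~ w))).

Lemma mean_L2 : (forall i, sq_integrable_rV P (y i)) ->
  sq_integrable_rV P (fun w => mean (y ^~ w)).
Proof. by move=> hy; apply: rV_sq_integrableZ; exact: rV_sq_integrable_sum. Qed.

Lemma dist_errE : (0 < n)%N -> (forall i, sq_integrable_rV P (y i)) ->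
  dist_err = n%:R * opt_err + cons_err.
Proof.
move=> hn hy; have hm := mean_L2 hy.
have hz := rV_sq_integrable_cst P z.
have i1 i : summable P (fun w => sqnorm (y i w - z)).
  exact/summable_sqnorm/rV_sq_integrableB.
have i2 i : summable P (fun w => sqnorm (y i w - mean (y ^~ w))).
  exact/summable_sqnorm/rV_sq_integrableB.
have i3 : summable P (fun w => sqnorm (mean (y ^~ w) - z)).
  exact/summable_sqnorm/rV_sq_integrableB.
rewrite /dist_err /cons_err -!expect_sum // /opt_err -expectZ //.
rewrite -expectD; [|exact: summableZ|exact: summable_sum].
by congr expect; apply/funext => w; exact: (bias_variance hn).
Qed.

End errors.

(** With the Young weight [lam] equal to half the gap [1 - s], the factor
    [s * (1 + lam)] stays below [1 - lam] and [s * (1 + lam^-1)] below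
    [lam^-1]. *)
Lemma consensus_contraction (R : realFieldType) (s lam M v G Q : R) :
  0 < lam -> s = 1 - 2 * lam -> 2 * lam <= 1 -> 0 <= M -> 0 <= v -> 0 <= G ->
  0 <= Q ->
  s * ((1 + lam) * v + (1 + lam^-1 + M) * G + Q) <=
  (1 - lam) * v + (lam^-1 + M) * G + Q.
Proof.
move=> l0 -> l1 M0 v0 G0 Q0; rewrite !mulrDr !mulrA; apply: lerD; first apply: lerD.
- by apply: ler_wpM2r => //; nra.
- apply: ler_wpM2r => //.
  have -> : (1 - 2 * lam) * (1 + lam^-1 + M) = lam^-1 - 1 - 2 * lam + (1 - 2 * lam) * M.
    by field; rewrite gt_eqF.
  have : (1 - 2 * lam) * M <= M by rewrite ler_piMl //; lra.
  by lra.
- by rewrite ler_piMl //; lra.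
Qed.

Section dsgd_process.
Context {R : realType} {n p m : nat} (mu L sigma M : R).
Hypotheses (hn : (0 < n)%N) (hmu : 0 < mu) (hL : 0 < L) (hM : 0 < M).
Context (f : 'I_n -> 'rV[R]_p -> R).
Hypothesis hf : forall i, strongly_convex_smooth mu L (f i).
Context (xs : 'rV[R]_p) (hxs : is_minimizer (average f) xs).
Context (E : rel 'I_n) (W : 'M[R]_n) (hW : mixing_matrix E W).
Context (d : measure_display) (T : measurableType d) (P : probability T R).
Context (xi : nat -> 'I_n -> T -> 'rV[R]_m).
Hypothesis hxi : forall k i, measurable_fun setT (xi k i).
Context (g : 'I_n -> 'rV[R]_p -> 'rV[R]_m -> 'rV[R]_p).
Hypothesis hg : forall i, measurable_fun setT
  (fun z : 'rV[R]_p * 'rV[R]_m => g i z.1 z.2).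
Context (x0 : 'I_n -> 'rV[R]_p) (alpha : nat -> R).

Let x := dsgd W alpha g xi x0.
Let gs := sgrad W alpha g xi x0.
Hypothesis noise : noise_assumption P sigma M f x gs xi.

Let past k : set (set T) := \bigcup_(l in [set l : nat | (l <= k)%N])
  \bigcup_(i in [set: 'I_n]) g_sigma_algebra_preimage (x l i).
Let gr k i w : 'rV[R]_p := gradient (f i) (x k i w).
Let e k i w : 'rV[R]_p := gs k i w - gr k i w.

Lemma measurable_dsgd k i : measurable_fun setT (x k i).
Proof.
elim: k i => [|k IH] i; first exact: measurable_cst.
apply: measurable_rV => c; rewrite /x /=.
under eq_fun do rewrite summxE.
apply: measurable_sum => j.
under eq_fun do rewrite !mxE.
apply: measurable_funM => //; apply: measurable_funB.
  by apply: (measurableT_comp (measurable_coord c)); exact: IH.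
apply: measurable_funM => //; apply: (measurableT_comp (measurable_coord c)).
apply: (measurableT_comp (hg j) (g := fun w => (x k j w, xi k j w))).
by apply: measurable_fun_pair; [exact: IH|exact: hxi].
Qed.

Lemma past_measurable k : <<s past k>> `<=` measurable.
Proof.
apply: smallest_sub; first exact: sigma_algebra_measurable.
move=> A [l _ [i _ [B mB <-]]]; exact: measurable_dsgd.
Qed.

Lemma adapted_dsgd k i : adapted (past k) (x k i).
Proof.
move=> _ B mB; apply: sub_sigma_algebra; exists k => //=.
by exists i => //; exists B.
Qed.

Lemma noise_condexp k i c : is_condexp P (fun w => gs k i w 0 c) <<s past k>>
  (fun w => gr k i w 0 c).
Proof. by have [_ h _] := noise k; exact: h. Qed.

Lemma adapted_gradient k i c : adapted (past k) (fun w => gr k i w 0 c).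
Proof. by have [] := condexpP (@past_measurable k) (noise_condexp k i c). Qed.

Lemma noise_centred k i c : orth P <<s past k>> (fun w => e k i w 0 c).
Proof.
have [_ _ _] := condexpP (@past_measurable k) (noise_condexp k i c).
by congr (orth _ _ _); apply/funext => w; rewrite !mxE.
Qed.

Lemma adapted_coord G (u : T -> 'rV[R]_p) c :
  adapted G u -> adapted G (fun w => u w 0 c).
Proof. by move=> au; exact: (measurableT_comp (measurable_coord c)). Qed.

(** Given the past, the only source of randomness in the noise of agent [i] is
    its own sample. *)
Lemma noise_adapted k i c :
  adapted (joint (xi k) (past k) i) (fun w => e k i w 0 c).
Proof.
have agr : adapted (joint (xi k) (past k) i) (fun w => gr k i w 0 c).
  by apply: adapted_joint; exact: (@adapted_gradient k i c).
have ax : adapted (joint (xi k) (past k) i) (x k i).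
  by apply: adapted_joint; exact: (@adapted_dsgd k i).
have axi : adapted (joint (xi k) (past k) i) (xi k i).
  exact: adapted_joint_self.
have -> : (fun w => e k i w 0 c) = (fun w => gs k i w 0 c - gr k i w 0 c).
  by apply/funext => w; rewrite /e !mxE.
apply: measurable_funB agr.
have pairm := measurable_fun_pair ax axi.
exact: (measurableT_comp (measurable_coord c) (measurableT_comp (hg i) pairm)).
Qed.

(** Both parts come from the bound on the conditional second moment, tested on
    the whole space; the first one is what makes all the iterates
    square-integrable. *)
Lemma noise_variance k i : summable P (fun w => sqnorm (e k i w)) /\
  (sq_integrable_rV P (gr k i) -> expect P (fun w => sqnorm (e k i w)) <=
    sigma ^+ 2 + M * expect P (fun w => sqnorm (gr k i w))).
Proof.
have [_ _ /(_ i) [Z [cZ Zle]]] := noise k.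
have [iX iZ _ oZ] := condexpP (@past_measurable k) cZ.
split=> // L2g.
have -> : expect P (fun w => sqnorm (e k i w)) = expect P Z.
  apply/eqP; rewrite -subr_eq0 -expectB //; apply/eqP.
  rewrite -(oZ setT); last exact: (@measurableT _ (g_sigma_algebraType (past k))).
  by congr expect; apply/funext => w; rewrite (indicE _ setT) in_setT mulr1.
have ig := summable_sqnorm L2g.
have iMg : summable P (fun w => M * sqnorm (gr k i w)) by exact: summableZ.
have := @expect_le_ae _ _ _ P Z (fun w => sigma ^+ 2 + M * sqnorm (gr k i w)).
rewrite (expectD (summable_cst _ _) iMg) expect_cst expectZ //; apply => //.
exact: summableD (summable_cst _ _) iMg.
Qed.

Lemma gradient_L2 k i :
  sq_integrable_rV P (x k i) -> sq_integrable_rV P (gr k i).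
Proof.
move=> hx; have ix := summable_sqnorm (rV_sq_integrableB hx (rV_sq_integrable_cst P xs)).
apply: (sqnorm_sq_integrable (Y := fun w => (1 + 1) * sqnorm (gradient (f i) xs)
   + (1 + 1^-1) * (L ^+ 2 * sqnorm (x k i w - xs)))).
- by move=> c; apply: adapted_measurable (@past_measurable k) _;
    exact: adapted_gradient.
- by move=> w; apply: (gradient_growth hL hf).
- apply: summableD; first exact: summable_cst.
  by do 2 apply: summableZ.
Qed.

Lemma noise_L2 k i : sq_integrable_rV P (e k i).
Proof.
have [iv _] := noise_variance k i.
apply: (sqnorm_sq_integrable _ _ iv) => // c.
apply: (adapted_measurable _ (@noise_adapted k i c)).
apply: sigma_joint_measurable => //; exact: past_measurable.
Qed.

(** By induction: gradients grow at most linearly, and the noise has finite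
    second moment. *)
Lemma dsgd_L2 k i : sq_integrable_rV P (x k i).
Proof.
elim: k i => [|k IH] i; first exact: rV_sq_integrable_cst.
rewrite (_ : x k.+1 i =
  fun w => \sum_j W i j *: (x k j w - alpha k *: gs k j w)) //.
apply: rV_sq_integrable_sum => j; apply: rV_sq_integrableZ.
apply: rV_sq_integrableB => //; apply: rV_sq_integrableZ.
have -> : gs k j = (fun w => gr k j w + e k j w).
  by apply/funext => w; rewrite /e addrC subrK.
by apply: rV_sq_integrableD; [exact: gradient_L2|exact: noise_L2].
Qed.

Lemma sgrad_L2 k j : sq_integrable_rV P (gs k j).
Proof.
rewrite (_ : gs k j = fun w => gr k j w + e k j w); last first.
  by apply/funext => w; rewrite /e addrC subrK.
by apply: rV_sq_integrableD; [exact/gradient_L2/dsgd_L2|exact: noise_L2].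
Qed.

Lemma noise_uncorrelated k i j c : i != j ->
  expect P (fun w => e k i w 0 c * e k j w 0 c) = 0.
Proof.
move=> ij; have [ind _ _] := noise k.
apply: (cond_independent_orth (@past_measurable k) (hxi k) ind ij).
- exact: noise_adapted.
- exact: noise_adapted.
- exact/sq_integrable_summable/noise_L2.
- exact: noise_centred.
- by apply: summableM; exact: noise_L2.
Qed.

Let B := grad_dissim f xs.
Let rho := rho_w W.
Let N : R := n%:R.
Let H k := dist_err P (x k) xs.
Let r k := opt_err P (x k) xs.
Let v k := cons_err P (x k).

Lemma adapted_affine k (u : T -> 'rV[R]_p) a i :
  (forall c, adapted (past k) (fun w => u w 0 c)) ->
  forall c, adapted (past k) (fun w => (x k i w - u w - a *: gr k i w) 0 c).
Proof.
move=> au c; have ax := adapted_coord c (@adapted_dsgd k i).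
have ag := @adapted_gradient k i c.
rewrite (_ : (fun w => _) = (fun w => x k i w 0 c - u w 0 c - a * gr k i w 0 c)).
  apply: measurable_funB; first exact: measurable_funB ax (au c).
  by apply: measurable_funM => //; exact: ag.
by apply/funext => w; rewrite !mxE.
Qed.

(** The noise is orthogonal to everything that is determined by the past. *)
Lemma step_agent k i (u : T -> 'rV[R]_p) : sq_integrable_rV P u ->
  (forall c, adapted (past k) (fun w => u w 0 c)) ->
  expect P (fun w => sqnorm (x k i w - alpha k *: gs k i w - u w)) <=
  expect P (fun w => sqnorm (x k i w - u w - alpha k *: gr k i w))
  + alpha k ^+ 2 * (sigma ^+ 2 + M * expect P (fun w => sqnorm (gr k i w))).
Proof.
move=> hu au; have hx := dsgd_L2 k i; have hg' := gradient_L2 hx.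
have hZ : sq_integrable_rV P (fun w => x k i w - u w - alpha k *: gr k i w).
  by do 2 ?apply: rV_sq_integrableB => //; exact: rV_sq_integrableZ.
have := @expect_sqnormB _ _ _ P _ (alpha k) _ _ hZ (noise_L2 k i).
have -> : (fun w => sqnorm (x k i w - u w - alpha k *: gr k i w -
     alpha k *: e k i w)) = (fun w => sqnorm (x k i w - alpha k *: gs k i w - u w)).
  apply/funext => w; congr sqnorm; rewrite -addrA -opprD -scalerDr /e.
  by rewrite [_ + (_ - _)]addrC subrK addrAC.
move=> ->; last first.
  apply: (@noise_orth _ _ _ P _ _ (past k) (e k)) => //.
  - exact: past_measurable.
  - by move=> j; exact: noise_L2.
  - by move=> j c; exact: noise_centred.
  - exact: adapted_affine.
by rewrite lerD2l ler_wpM2l ?sqr_ge0 //; have [_] := noise_variance k i; exact.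
Qed.

(** Mixing does not increase the sum of the squared distances to a fixed point, so
    it suffices to follow the gradient step of each agent separately. *)
Lemma dist_recursion k : 0 <= alpha k ->
  2 * (1 + M) * (alpha k * L ^+ 2) <= mu ->
  H k.+1 <= (1 - alpha k * mu / 2) * H k
  + alpha k * (2 / mu * B + 2 * alpha k * (1 + M) * B + alpha k * N * sigma ^+ 2).
Proof.
move=> a0 aL; set a := alpha k in a0 aL *.
have hz := rV_sq_integrable_cst P xs.
have hu j : sq_integrable_rV P (fun w => x k j w - a *: gs k j w - xs).
  do 2 ?apply: rV_sq_integrableB => //; first exact: dsgd_L2.
  exact/rV_sq_integrableZ/sgrad_L2.
have h1 : H k.+1 <= \sum_j expect P (fun w => sqnorm (x k j w - a *: gs k j w - xs)).
  rewrite /H /dist_err -!expect_sum.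
  - apply: expect_le.
    + apply: summable_sum => i; apply/summable_sqnorm/rV_sq_integrableB => //.
      exact: dsgd_L2.
    + by apply: summable_sum => i; exact: summable_sqnorm.
    + move=> w; exact: (mix_dist hW (fun j => x k j w - a *: gs k j w) xs).
  - by move=> i; exact: summable_sqnorm.
  - move=> i; apply/summable_sqnorm/rV_sq_integrableB => //; exact: dsgd_L2.
apply: (le_trans h1).
have -> : (1 - a * mu / 2) * H k
  + a * (2 / mu * B + 2 * a * (1 + M) * B + a * N * sigma ^+ 2) =
  \sum_j ((1 - a * mu / 2) * expect P (fun w => sqnorm (x k j w - xs)) +
    a * (2 / mu + 2 * a * (1 + M)) * sqnorm (gradient (f j) xs)
    + a ^+ 2 * sigma ^+ 2).
  rewrite !big_split /= -!mulr_sumr sumr_const card_ord -/(dist_err P (x k) xs).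
  by rewrite -/(H k) -/(grad_dissim f xs) -/B /N; ring.
apply: ler_sum => j _.
have az c : adapted (past k) (fun w : T => xs 0 c) by exact: measurable_cst.
apply: (le_trans (step_agent j hz az)).
have hx := dsgd_L2 k j; have hgr := gradient_L2 hx.
have ig := summable_sqnorm hgr.
have ix := summable_sqnorm (rV_sq_integrableB hx hz).
have id : summable P (fun w => sqnorm (x k j w - xs - a *: gr k j w)).
  by apply/summable_sqnorm/rV_sq_integrableB;
    [exact: rV_sq_integrableB|exact: rV_sq_integrableZ].
pose c2 := a * (2 / mu + 2 * a * (1 + M)) * sqnorm (gradient (f j) xs).
have ig2 : summable P (fun w => a ^+ 2 * M * sqnorm (gr k j w)) by exact: summableZ.
have ix2 : summable P (fun w => (1 - a * mu / 2) * sqnorm (x k j w - xs)).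
  exact: summableZ.
have key : expect P (fun w => sqnorm (x k j w - xs - a *: gr k j w)
      + a ^+ 2 * M * sqnorm (gr k j w)) <=
    expect P (fun w => (1 - a * mu / 2) * sqnorm (x k j w - xs) + c2).
  apply: expect_le; [exact: summableD| |].
    by apply: summableD => //; exact: summable_cst.
  by move=> w; apply: (agent_descent hmu hL hf) => //; exact: ltW.
rewrite (expectD id ig2) (expectD ix2 (summable_cst P c2)) expect_cst in key.
rewrite (expectZ _ ig) (expectZ _ ix) in key.
rewrite -/a; move: key; rewrite -/c2.
set X1 := expect P _; set X2 := expect P _; set X3 := expect P _.
by lra.
Qed.

Lemma gradient_err k delta : 0 < delta ->
  \sum_i expect P (fun w => sqnorm (gr k i w)) <=
  (1 + delta) * B + (1 + delta^-1) * (L ^+ 2 * H k).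
Proof.
move=> d0; rewrite /B /H /grad_dissim /dist_err !mulr_sumr -big_split /=.
apply: ler_sum => i _; have hx := dsgd_L2 k i.
have ix := summable_sqnorm (rV_sq_integrableB hx (rV_sq_integrable_cst P xs)).
pose c := (1 + delta) * sqnorm (gradient (f i) xs).
have ix2 : summable P (fun w => (1 + delta^-1) * L ^+ 2 * sqnorm (x k i w - xs)).
  exact: summableZ.
rewrite mulrA -(expectZ _ ix) -/c -(expect_cst P c).
rewrite -(expectD (summable_cst P c) ix2).
apply: expect_le.
- exact/summable_sqnorm/gradient_L2.
- by apply: summableD => //; exact: summable_cst.
by move=> w; rewrite -mulrA; exact: (gradient_growth hL hf).
Qed.

Lemma adapted_mean k c : adapted (past k) (fun w => mean (x k ^~ w) 0 c).
Proof.
rewrite (_ : (fun w => _) = (fun w => n%:R^-1 * \sum_i x k i w 0 c)).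
  apply: measurable_funM => //; apply: measurable_sum => i.
  exact: (adapted_coord c (@adapted_dsgd k i)).
by apply/funext => w; rewrite /mean !mxE summxE.
Qed.

(** The mixing contracts the deviations from the previous average of the agents;
    Young's inequality separates these deviations from the gradients. *)
Lemma cons_recursion k (lam := (1 - rho ^+ 2) / 2) : 0 <= rho < 1 ->
  v k.+1 <= (1 - lam) * v k
  + alpha k ^+ 2 * ((lam^-1 + M) * (2 * L ^+ 2 * H k + 2 * B) + N * sigma ^+ 2).
Proof.
move=> /andP[rho0 rho1]; set a := alpha k.
have lam0 : 0 < lam by rewrite divr_gt0 // subr_gt0 exprn_ilt1.
pose mu_ w := mean (x k ^~ w).
have hm : sq_integrable_rV P mu_ by apply: mean_L2 => i; exact: dsgd_L2.
have hu j : sq_integrable_rV P (fun w => x k j w - a *: gs k j w - mu_ w).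
  apply: rV_sq_integrableB => //; apply: rV_sq_integrableB; first exact: dsgd_L2.
  exact/rV_sq_integrableZ/sgrad_L2.
have hx1 i : sq_integrable_rV P (fun w => x k.+1 i w - mean (x k.+1 ^~ w)).
  apply: rV_sq_integrableB; first exact: dsgd_L2.
  by apply: mean_L2 => j; exact: dsgd_L2.
have h1 : v k.+1 <= rho ^+ 2 *
    \sum_j expect P (fun w => sqnorm (x k j w - a *: gs k j w - mu_ w)).
  have iu j := summable_sqnorm (hu j).
  have ix1 i := summable_sqnorm (hx1 i).
  rewrite /v /cons_err -!expect_sum // -expectZ; last exact: summable_sum.
  apply: expect_le; first exact: summable_sum.
    by apply: summableZ; exact: summable_sum.
  by move=> w; exact: (mix_consensus hn hW (fun j => x k j w - a *: gs k j w)).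
apply: (le_trans h1).
pose G := \sum_i expect P (fun w => sqnorm (gr k i w)).
have h2 : \sum_j expect P (fun w => sqnorm (x k j w - a *: gs k j w - mu_ w)) <=
    (1 + lam) * v k + (1 + lam^-1 + M) * (a ^+ 2 * G) + a ^+ 2 * (N * sigma ^+ 2).
  have -> : (1 + lam) * v k + (1 + lam^-1 + M) * (a ^+ 2 * G)
      + a ^+ 2 * (N * sigma ^+ 2) =
    \sum_j ((1 + lam) * expect P (fun w => sqnorm (x k j w - mu_ w))
      + (1 + lam^-1) * (a ^+ 2 * expect P (fun w => sqnorm (gr k j w)))
      + a ^+ 2 * (sigma ^+ 2 + M * expect P (fun w => sqnorm (gr k j w)))).
    rewrite !big_split /= -!mulr_sumr big_split /= sumr_const card_ord -!mulr_sumr.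
    by rewrite -/(cons_err P (x k)) -/(v k) -/G /N; ring.
  apply: ler_sum => j _.
  apply: (le_trans (step_agent j hm (@adapted_mean k))).
  rewrite lerD2r.
  have hxm : sq_integrable_rV P (fun w => x k j w - mu_ w).
    by apply: rV_sq_integrableB => //; exact: dsgd_L2.
  have hgr : sq_integrable_rV P (gr k j) by exact/gradient_L2/dsgd_L2.
  have i1 := summable_sqnorm hxm; have i2 := summable_sqnorm hgr.
  have i3 : summable P (fun w => (1 + lam) * sqnorm (x k j w - mu_ w)).
    exact: summableZ.
  have i4 : summable P (fun w => (1 + lam^-1) * a ^+ 2 * sqnorm (gr k j w)).
    exact: summableZ.
  rewrite mulrA -(expectZ _ i1) -(expectZ _ i2) -(expectD i3 i4).
  apply: expect_le.
  - apply: summable_sqnorm; apply: rV_sq_integrableB => //.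
    exact: rV_sq_integrableZ.
  - exact: summableD.
  move=> w; have := young_sqnorm (x k j w - mu_ w) (- (a *: gr k j w)) lam0.
  by rewrite sqnormN sqnormZ mulrA.
apply: (le_trans (ler_wpM2l (sqr_ge0 rho) h2)).
apply: (le_trans (consensus_contraction _ _ _ _ _ _ _)) => //.
- by rewrite /lam mulrC divfK ?pnatr_eq0 // subKr.
- by rewrite /lam mulrC divfK ?pnatr_eq0 // lerBlDr lerDl sqr_ge0.
- exact: ltW.
- by apply: sumr_ge0 => i _; apply: expect_ge0 => w; exact: sqnorm_ge0.
- rewrite mulr_ge0 ?sqr_ge0 // sumr_ge0 // => i _.
  by apply: expect_ge0 => w; exact: sqnorm_ge0.
- exact: mulr_ge0 (sqr_ge0 _) (mulr_ge0 (ler0n _ _) (sqr_ge0 _)).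
have G2 : G <= 2 * L ^+ 2 * H k + 2 * B.
  apply: (le_trans (gradient_err k ltr01)).
  by rewrite invr1 addrC mulrA.
rewrite [in leRHS]mulrDr addrA lerD2r lerD2l mulrCA ler_wpM2l ?sqr_ge0 //.
by rewrite ler_wpM2l // addr_ge0 ?invr_ge0 ?(ltW hM) // ltW.
Qed.

(** Mixing preserves the average, which therefore follows [mean_descent] up to an
    orthogonal noise with the variance of an average of uncorrelated terms. *)
Lemma opt_recursion k delta eta : 0 < delta -> 0 < eta -> 0 <= alpha k ->
  alpha k * L ^+ 2 <= 2 * mu ->
  r k.+1 <= (1 - 2 * alpha k * mu + alpha k ^+ 2 * L ^+ 2 + alpha k * eta) * r k
   + (alpha k * L ^+ 2 / eta + alpha k ^+ 2 * L ^+ 2) * (v k / N)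
   + alpha k ^+ 2 * ((sigma ^+ 2 + (1 + delta) * M * B / N) / N
       + (1 + delta^-1) * M * L ^+ 2 / N * (r k + v k / N)).
Proof.
move=> d0 e0 a0 aL; set a := alpha k in a0 aL *.
have N0 : 0 < N by rewrite /N ltr0n.
pose m_ w := mean (x k ^~ w); pose gm w := mean (fun i => gr k i w).
have hm : sq_integrable_rV P m_ by apply: mean_L2 => i; exact: dsgd_L2.
have hgr i : sq_integrable_rV P (gr k i) by exact/gradient_L2/dsgd_L2.
have hgm : sq_integrable_rV P gm.
  by apply: rV_sq_integrableZ; exact: rV_sq_integrable_sum.
have hz := rV_sq_integrable_cst P xs.
have hZ : sq_integrable_rV P (fun w => m_ w - xs - a *: gm w).
  by apply: rV_sq_integrableB; [exact: rV_sq_integrableB|exact: rV_sq_integrableZ].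
have he := noise_L2 k.
have hme := @mean_noise_L2 _ _ _ P _ _ (e k) he.
have rE : r k.+1 = expect P (fun w => sqnorm (m_ w - xs - a *: gm w
    - a *: mean (fun i => e k i w))).
  congr expect; apply/funext => w; congr sqnorm.
  rewrite -[x k.+1 ^~ w]/(mix W (fun j => x k j w - a *: gs k j w)) (mean_mix hW).
  have -> : mean (fun j => x k j w - a *: gs k j w) =
      m_ w - a *: mean (fun j => gs k j w) by rewrite meanB meanZ.
  rewrite -[RHS]addrA -opprD -scalerDr -meanD addrAC; congr (_ - _ *: _).
  by congr mean; apply/funext => i; rewrite /e addrC subrK.
have oZ : expect P (fun w => dotp (m_ w - xs - a *: gm w)
    (mean (fun i => e k i w))) = 0.
  apply: (@mean_noise_orth _ _ _ P _ _ (past k) (e k)) => //.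
  - exact: past_measurable.
  - by move=> j c; exact: noise_centred.
  - move=> c; have am := @adapted_mean k c.
    rewrite (_ : (fun w => _) = (fun w => m_ w 0 c - xs 0 c
        - a * (n%:R^-1 * \sum_i gr k i w 0 c))).
      apply: measurable_funB; first exact: measurable_funB am (measurable_cst _).
      apply: measurable_funM => //; apply: measurable_funM => //.
      by apply: measurable_sum => i; exact: (@adapted_gradient k i c).
    have coordB (u u' : 'rV[R]_p) : (u - u') 0 c = u 0 c - u' 0 c by rewrite !mxE.
    have coordZ b (u : 'rV[R]_p) : (b *: u) 0 c = b * u 0 c by rewrite mxE.
    have gmE w : gm w 0 c = n%:R^-1 * \sum_i gr k i w 0 c.
      by rewrite /gm /mean coordZ summxE.
    by apply/funext => w; rewrite !coordB (coordZ a) gmE.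
rewrite rE (expect_sqnormB a hZ hme oZ).
rewrite (@mean_noise_variance _ _ _ P _ _ (e k) he); last first.
  by move=> i j c; exact: noise_uncorrelated.
pose G := \sum_i expect P (fun w => sqnorm (gr k i w)).
have var : \sum_i expect P (fun w => sqnorm (e k i w)) <=
    N * sigma ^+ 2 + M * G.
  have -> : N * sigma ^+ 2 + M * G = \sum_i (sigma ^+ 2 +
      M * expect P (fun w => sqnorm (gr k i w))).
    by rewrite big_split /= sumr_const card_ord -mulr_sumr /N mulr_natl.
  by apply: ler_sum => i _; have [_] := noise_variance k i; exact.
have HE : H k = N * r k + v k.
  by apply: dist_errE => // i; exact: dsgd_L2.
have GB := gradient_err k d0; rewrite -/G HE in GB.
have desc : expect P (fun w => sqnorm (m_ w - xs - a *: gm w)) <=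
  (1 - 2 * a * mu + a ^+ 2 * L ^+ 2 + a * eta) * r k
   + (a * L ^+ 2 / eta + a ^+ 2 * L ^+ 2) * (v k / N).
  have i1 : summable P (fun w => sqnorm (m_ w - xs)).
    exact/summable_sqnorm/rV_sq_integrableB.
  have i2 i : summable P (fun w => sqnorm (x k i w - m_ w)).
    by apply/summable_sqnorm/rV_sq_integrableB => //; exact: dsgd_L2.
  have i3 := summable_sum (index_enum 'I_n) i2.
  have -> : v k / N = expect P (fun w => n%:R^-1 * \sum_i sqnorm (x k i w - m_ w)).
    by rewrite expectZ // expect_sum // mulrC.
  have i4 : summable P (fun w => n%:R^-1 * \sum_i sqnorm (x k i w - m_ w)).
    exact: summableZ.
  rewrite -(expectZ _ i1) -(expectZ _ i4) -expectD; last 2 first.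
  - exact: summableZ.
  - exact: summableZ.
  apply: expect_le; first exact: summable_sqnorm.
    by apply: summableD; exact: summableZ.
  move=> w; apply: (mean_descent hn hL hf) => //.
  exact: (sum_gradient_minimizer hn hf).
apply: lerD => //; rewrite ler_wpM2l ?sqr_ge0 //.
apply: (@le_trans _ _ (n%:R ^- 2 * (N * sigma ^+ 2 + M *
    ((1 + delta) * B + (1 + delta^-1) * (L ^+ 2 * (N * r k + v k)))))).
  rewrite ler_wpM2l ?invr_ge0 ?sqr_ge0 //; apply: (le_trans var).
  by rewrite lerD2l ler_wpM2l // ltW.
rewrite -/N le_eqVlt; apply/orP; left; apply/eqP.
by field; rewrite !gt_eqF.
Qed.

End dsgd_process.

(** * The convergence rate *)

(** Compare both conditions at two points at distance 1. *)
Lemma strong_convexity_le_smoothness (R : realType) p (mu L : R)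
    (f : 'rV[R]_p -> R) :
  (0 < p)%N -> 0 < mu -> 0 < L -> strongly_convex_smooth mu L f -> mu <= L.
Proof.
move=> hp hmu hL [_ mono lip].
pose z : 'rV[R]_p := delta_mx 0 (Ordinal hp).
have z1 : sqnorm (z - 0) = 1.
  rewrite subr0 /sqnorm /dotp (bigD1 (Ordinal hp)) //= big1 => [|j jp].
    by rewrite !mxE !eqxx mulr1 addr0.
  by rewrite !mxE (negbTE jp) andbF mul0r.
have := mono z 0; rewrite z1 mulr1 => h1.
have := le_norm2 (ltW hL) (lip z 0); rewrite z1 mulr1 => h2.
rewrite -ler_sqr ?nnegrE ?(ltW hmu) ?(ltW hL) //.
apply: le_trans h2; rewrite -[leRHS]mulr1 -z1.
apply: le_trans (dotp_sqr_le _ _).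
by rewrite ler_sqr ?nnegrE // ?(ltW hmu) // (le_trans (ltW hmu)).
Qed.

(** The upper bound makes the initial value [K] of [t], hence the constants,
    bounded in terms of the parameters. *)
Lemma shiftK_bounds (R : realType) (theta mu L M : R) :
  minshift theta mu L M <= (shiftK theta mu L M)%:~R <= minshift theta mu L M + 1.
Proof.
rewrite /shiftK -/(minshift theta mu L M).
have /andP[lo ->] := ceil_itv (minshift theta mu L M).
by move: lo; rewrite intrD mulrN1z ltrBlDr => /ltW.
Qed.

Lemma powR_3_2 (R : realType) (t : R) : 0 < t -> t `^ (3 / 2) = t * Num.sqrt t.
Proof.
move=> t0; have -> : 3 / 2 = 1 + 2^-1 :> R by field.
by rewrite powRD ?gt_eqF ?implybT // powRr1 ?(ltW t0) // powR12_sqrt ?(ltW t0).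
Qed.

Theorem theorem1 (R : realType) (theta mu L sigma M : R)
    (htheta : 2 < theta) (hmu : 0 < mu) (hL : 0 < L)
    (hsigma : 0 < sigma) (hM : 0 < M) :
  exists C1 C2 : R, [/\ 0 <= C1, 0 <= C2 &
  forall (n p m : nat) (hn : (1 <= n)%N) (hp : (1 <= p)%N) (hm : (1 <= m)%N)
    (f : 'I_n -> 'rV[R]_p -> R)
    (hf : forall i, strongly_convex_smooth mu L (f i))
    (xs : 'rV[R]_p) (hxs : is_minimizer (average f) xs)
    (E : rel 'I_n) (hE : connected_graph E)
    (W : 'M[R]_n) (hW : mixing_matrix E W) (hrho : rho_w W < 1)
    (d : measure_display) (T : measurableType d) (P : probability T R)
    (xi : nat -> 'I_n -> T -> 'rV[R]_m)
    (hxi : forall k i, measurable_fun setT (xi k i))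
    (g : 'I_n -> 'rV[R]_p -> 'rV[R]_m -> 'rV[R]_p)
    (hg : forall i, measurable_fun setT
            (fun z : 'rV[R]_p * 'rV[R]_m => g i z.1 z.2))
    (x0 : 'I_n -> 'rV[R]_p),
    let K := shiftK theta mu L M in
    let K1 := transientK1 K (rho_w W) in
    let alpha := stepsize theta mu K in
    let x := dsgd W alpha g xi x0 in
    let A := init_dist x0 xs in
    let B := grad_dissim f xs in
    noise_assumption P sigma M f x (sgrad W alpha g xi x0) xi ->
    forall k : nat, (K1 - K <= k%:Z)%R ->
    let tk : R := (k%:Z + K)%:~R in
    ((n%:R^-1)%:E * \sum_(i < n) 'E_P[fun w => sqnorm (x k i w - xs)]
     <= (theta ^+ 2 * Mbar sigma M f xs
           / ((2 * theta - 1) * n%:R * mu ^+ 2 * tk)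
         + C1 * (Num.sqrt (A + B + n%:R) / (n%:R * (1 - rho_w W)))
             * (tk `^ (3 / 2))^-1
         + C2 * ((A + B + n%:R) / (n%:R * (1 - rho_w W) ^+ 2))
             * (tk ^+ 2)^-1)%:E)%E].
Proof.
(* The constants are known to be nonnegative only when [mu <= L], which the
   existence of the objectives entails. *)
exists (Num.max 0 (mix_const theta mu L sigma M)),
  (Num.max 0 (mse_const theta mu L sigma M)).
split; [by rewrite le_max lexx|by rewrite le_max lexx|].
move=> n p m hn hp hm f hf xs hxs E hE W hW hrho d T P xi hxi g hg x0.
move=> K K1 alpha x A B noise k _; cbv zeta; set tk : R := (k%:Z + K)%:~R.
have hLmu : mu <= L.
  exact: strong_convexity_le_smoothness hp hmu hL (hf (Ordinal hn)).
have /andP[kap_ge kap_le] := shiftK_bounds theta mu L M.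
rewrite -/K in kap_ge kap_le; set kap : R := K%:~R in kap_ge kap_le.
have hN : 1 <= n%:R :> R by rewrite ler1n.
have N0 : 0 < n%:R :> R by rewrite ltr0n.
have hA : 0 <= A by apply: sumr_ge0 => i _; exact: sqnorm_ge0.
have hB : 0 <= B by apply: sumr_ge0 => i _; exact: sqnorm_ge0.
have rho01 : 0 <= rho_w W < 1 by rewrite spectral_norm_ge0.
pose t (j : nat) : R := (j%:Z + K)%:~R.
have tE j : t j = j%:R + kap by rewrite /t intrD.
have aE j : alpha j = theta / (mu * t j) by [].
have a0 := step_gt0 htheta hmu hL hsigma hM hN hA hB hLmu kap_ge kap_le tE aE.
have aL := step_smooth htheta hmu hL hsigma hM hN hA hB hLmu kap_ge kap_le tE aE.
have xL2 j i := dsgd_L2 hL hf xs hxi hg noise j i.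
pose r j := opt_err P (x j) xs; pose v j := cons_err P (x j).
have HE j : dist_err P (x j) xs = n%:R * r j + v j by exact: dist_errE.
have r0 j : 0 <= r j by apply: expect_ge0 => w; exact: sqnorm_ge0.
have v0 j : 0 <= v j.
  by apply: sumr_ge0 => i _; apply: expect_ge0 => w; exact: sqnorm_ge0.
have init : n%:R * r 0%N + v 0%N <= A.
  by rewrite -HE; apply: ler_sum => i _;
    rewrite -[leRHS](expect_cst P) lexx.
have dist_rec j : n%:R * r j.+1 + v j.+1 <=
    (1 - alpha j * mu / 2) * (n%:R * r j + v j) +
    alpha j * (2 / mu * B + 2 * alpha j * (1 + M) * B
               + alpha j * n%:R * sigma ^+ 2).
  by rewrite -!HE; apply: (dist_recursion hmu hL hM hf xs hW hxi hg noise _ (aL j));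
    exact/ltW.
have cons_rec j := cons_recursion hn hL hM hf xs hW hxi hg noise j rho01.
have aL2 j : alpha j * L ^+ 2 <= 2 * mu.
  have := aL j; have h0 := mulr_ge0 (ltW (a0 j)) (sqr_ge0 L).
  have := mulr_ge0 (ltW hM) h0; set u := alpha j * _; rewrite -/u in h0 *; lra.
have opt_rec j delta eta (delta0 : 0 < delta) (eta0 : 0 < eta) :=
  opt_recursion hn hL hM hf hxs hW hxi hg noise delta0 eta0 (ltW (a0 j)) (aL2 j).
have cons_rec' j : v j.+1 <= (1 - (1 - rho_w W ^+ 2) / 2) * v j +
    alpha j ^+ 2 * ((((1 - rho_w W ^+ 2) / 2)^-1 + M) *
      (2 * L ^+ 2 * (n%:R * r j + v j) + 2 * B) + n%:R * sigma ^+ 2).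
  by rewrite -HE; exact: cons_rec.
have bound := mse_bound htheta hmu hL hsigma hM hN rho01 hA hB hLmu kap_ge kap_le
  r0 v0 tE aE init dist_rec cons_rec' opt_rec k.
have t0 : 0 < tk by have := time_gt0 htheta hmu hL hsigma hM hN hA hB hLmu kap_ge kap_le tE k.
have lhsE : ((n%:R^-1)%:E * \sum_(i < n) 'E_P[fun w => sqnorm (x k i w - xs)])%E
    = (r k + v k / n%:R)%:E.
  under eq_bigr => i _.
    rewrite expectation_expect; last first.
      by apply/summable_sqnorm/rV_sq_integrableB => //; exact: rV_sq_integrable_cst.
    over.
  rewrite sumEFin -EFinM -/(dist_err P (x k) xs) HE; congr EFin.
  by field; rewrite gt_eqF.
have tkE : t k = tk by [].
rewrite tkE in bound; clear tkE; clearbody tk.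
rewrite lhsE lee_fin; apply: (le_trans bound).
case/andP: rho01 => rho0 rho1; have r1 : 0 < 1 - rho_w W by rewrite subr_gt0.
have S0 : 0 <= A + B + n%:R by rewrite !addr_ge0.
apply: lerD; first apply: lerD.
- rewrite le_eqVlt; apply/orP; left; apply/eqP.
  rewrite /Mbar -/(grad_dissim f xs) -/B.
  have t2 : 0 < 2 * theta - 1 by clear -htheta; lra.
  by field; rewrite !gt_eqF.
- rewrite (powR_3_2 t0); apply: ler_wpM2r.
    by rewrite invr_ge0 mulr_ge0 ?sqrtr_ge0 // ltW.
  have -> : n%:R^-1 * ((A + B + n%:R) / (n%:R * (1 - rho_w W) ^+ 2)) =
      (A + B + n%:R) * ((n%:R * (1 - rho_w W))^-1) ^+ 2.
    by field; rewrite !gt_eqF.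
  rewrite sqrtrM // sqrtr_sqr ger0_norm; last by rewrite invr_ge0 mulr_ge0 // ltW.
  apply: ler_wpM2r; last by rewrite le_max lexx orbT.
  by rewrite mulr_ge0 ?sqrtr_ge0 // invr_ge0 mulr_ge0 // ltW.
- apply: ler_wpM2r; first by rewrite invr_ge0 sqr_ge0.
  apply: ler_wpM2r; last by rewrite le_max lexx orbT.
  by rewrite divr_ge0 // mulr_ge0 ?sqr_ge0.
Qed.
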